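(* Let $H$ be a finite-dimensional Hopf algebra over a field $\Bbbk$, let $A\subseteq H$ be a Hopf subalgebra, and let $R:\mathrm{Rep}(H)\to\mathrm{Rep}(A)$ be the restriction functor. If $(K,T)$ is a dynamical datum for $H$ over $A$, then $T:\mathrm{Rep}(A)\to{}_K\mathcal{M}$ is a dynamical adjoint to $R$; that is, there is a family of isomorphisms $$\xi_{X,V,W}:\mathrm{Hom}_K(X\otimes_{\Bbbk}T(V),T(W))\to \mathrm{Hom}_A(R(X)\otimes_{\Bbbk}V,W),$$ natural in $X\in\mathrm{Rep}(H)$ and $V,W\in\mathrm{Rep}(A)$, such that for every $V\in\mathrm{Rep}(A)$ the map $\xi_{\Bbbk,V,V}$ sends the canonical isomorphism $\Bbbk\otimes_{\Bbbk}T(V)\to T(V)$ to the canonical isomorphism $\Bbbk\otimes_{\Bbbk}V\to V$.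
   Context: All algebras, categories and functors are $\Bbbk$-linear. $\mathcal{S},\varepsilon$ are the antipode and counit of $H$. $\mathrm{Rep}(H)$, $\mathrm{Rep}(A)$ are the tensor categories of finite-dimensional left modules; ${}_K\mathcal{M}$ is the category of finite-dimensional left $K$-modules. A left $H$-comodule algebra $K$ has coaction $k\mapsto k_{(-1)}\otimes k_{(0)}\in H\otimes K$; it is $H$-simple if it has no non-trivial two-sided ideal $I$ with $\delta(I)\subseteq H\otimes I$; it has trivial coinvariants if $K^{\mathrm{co}H}=\Bbbk$. For $X\in\mathrm{Rep}(H)$ and $M\in{}_K\mathcal{M}$, $X\otimes_{\Bbbk}M$ is a $K$-module by $k\cdot(x\otimes m)=k_{(-1)}\cdot x\otimes k_{(0)}\cdot m$. Yan–Zhu stabilizer. Let $K$ be a finite-dimensional left $H$-comodule algebra and $V,W$ left $K$-modules. $K$ acts on $H^*\otimes V$ by $k\cdot(\gamma\otimes v)=(k_{(-1)}\rightharpoondown\gamma)\otimes k_{(0)}\cdot v$, where $\langle h\rightharpoondown\gamma,t\rangle=\langle\gamma,\mathcal{S}^{-1}(h)t\rangle$. Let $\mathcal{L}:H^*\otimes\mathrm{Hom}(V,W)\to\mathrm{Hom}(H^*\otimes V,H^*\otimes W)$, $\mathcal{L}(\gamma\otimes f)(\xi\otimes v)=\gamma\xi\otimes f(v)$. Then $$\mathrm{Stab}_K(V,W)=\mathrm{Hom}_K(H^*\otimes V,H^*\otimes W)\cap\mathcal{L}(H^*\otimes\mathrm{Hom}(V,W)).$$ It is a left $H$-module through the action $\langle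 h\cdot\gamma,t\rangle=\langle\gamma,th\rangle$ on the factor $H^*$; $1\in\mathrm{Stab}_K(V,V)$ is the identity map. For $U\in\mathrm{Rep}(A)$, $\mathrm{Ind}^H_A U=H\otimes_A U$, with class $\overline{h\otimes u}$. The outer dual $(\mathrm{Ind}^H_AU)^*$ carries the action $(h\cdot\alpha)(z)=\alpha(\mathcal{S}(h)z)$, while in $V\otimes_{\Bbbk}W^*$ the module $W^*$ carries the action $(a\cdot f)(w)=f(\mathcal{S}^{-1}(a)w)$. A dynamical datum for $H$ over $A$ is a pair $(K,T)$ where $K$ is a finite-dimensional $H$-simple left $H$-comodule algebra with trivial coinvariants and $T:\mathrm{Rep}(A)\to{}_K\mathcal{M}$ is a functor, such that there are $H$-module isomorphisms, natural in $V,W\in\mathrm{Rep}(A)$, $$\omega_{VW}:\mathrm{Stab}_K(T(V),T(W))\to\big(\mathrm{Ind}^H_A(V\otimes_{\Bbbk}W^* )\big)^*,$$ with $\omega_{VV}(1)(\overline{h\otimes v\otimes f})=\langle\varepsilon,h\rangle\langle f,v\rangle$ for all $h\in H$, $v\in V$, $f\in V^*$. *)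

(* Defs.v *)
From HB Require Import structures.
From mathcomp Require Import all_boot all_algebra all_field.

Set Implicit Arguments.
Unset Strict Implicit.
Unset Printing Implicit Defensive.

Import GRing.Theory.
Local Open Scope ring_scope.

(* The tensor product of two finite-dimensional spaces is realised as the     *)
(* space of coordinate matrices, u ⊗ v being the matrix of the u_i v_j.       *)
Definition tens (k : fieldType) (U V : vectType k) : Type :=
  'M[k]_(\dim {:U}, \dim {:V}).
HB.instance Definition _ (k : fieldType) (U V : vectType k) :=
  Vector.on (tens U V).

Section Tensor.
Variable k : fieldType.
Implicit Types U V W : vectType k.

Definition pure U V (u : U) (v : V) : tens U V :=
  \matrix_(i, j) (coord (vbasis {:U}) i u * coord (vbasis {:V}) j v).
Local Notation "u ⊗ v" := (pure u v) (at level 40, left associativity).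

Lemma linfunE U V (f : U -> V) : linear f -> linfun f =1 f.
Proof.
move=> lf u; pose m := GRing.isLinear.Build k U V _ f lf.
by pose L : {linear U -> V} := HB.pack f m; rewrite -[RHS]/(L u) -(lfunE L).
Qed.

Definition bilin U V W (f : U -> V -> W) :=
  (forall v, linear (f^~ v)) /\ (forall u, linear (f u)).

Definition tsum U V W (f : U -> V -> W) (t : tens U V) : W :=
  \sum_i \sum_j (t : 'M_(_, _)) i j *: f (vbasis {:U})`_i (vbasis {:V})`_j.

Lemma tsum_is_linear U V W (f : U -> V -> W) : linear (tsum f).
Proof.
move=> a s t; rewrite /tsum scaler_sumr -big_split; apply: eq_bigr => i _ /=.
rewrite scaler_sumr -big_split; apply: eq_bigr => j _ /=.
by rewrite !mxE scalerDl scalerA.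
Qed.
HB.instance Definition _ U V W (f : U -> V -> W) :=
  GRing.isLinear.Build k (tens U V) W _ (tsum f) (@tsum_is_linear U V W f).

(* The linear map induced on U ⊗ V by the bilinear map f; see tliftE.         *)
Definition tlift U V W (f : U -> V -> W) : 'Hom(tens U V, W) := linfun (tsum f).

Lemma pure_bilin U V : bilin (@pure U V).
Proof.
split=> [v a x y|u a x y]; apply/matrixP=> i j; rewrite !mxE linearP /=.
  by rewrite mulrDl mulrA.
by rewrite mulrDr mulrCA.
Qed.

Lemma purePl U V a x y (v : V) : (a *: x + y : U) ⊗ v = a *: (x ⊗ v) + y ⊗ v.
Proof. by have [l _] := pure_bilin U V; rewrite l. Qed.

Lemma purePr U V a x y (u : U) : u ⊗ (a *: x + y : V) = a *: (u ⊗ x) + u ⊗ y.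
Proof. by have [_ r] := pure_bilin U V; rewrite r. Qed.

Lemma tliftE U V W (f : U -> V -> W) : bilin f ->
  forall u v, tlift f (u ⊗ v) = f u v.
Proof.
case=> fl fr u v; rewrite lfunE /= /tsum.
pose fL v := GRing.isLinear.Build k U W _ (f^~ v) (fl v).
pose gL v : {linear U -> W} := HB.pack (f^~ v) (fL v).
pose fR u := GRing.isLinear.Build k V W _ (f u) (fr u).
pose gR u : {linear V -> W} := HB.pack (f u) (fR u).
rewrite -[RHS]/(gL v u) [in RHS](coord_vbasis (memvf u)) linear_sum.
apply: eq_bigr => i _; rewrite linearZ.
rewrite -[gL v _]/(gR (vbasis {:U})`_i v) [in RHS](coord_vbasis (memvf v)).
rewrite [in RHS]linear_sum [RHS]scaler_sumr; apply: eq_bigr => j _.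
by rewrite linearZ scalerA !mxE.
Qed.

Lemma tens_sum U V (t : tens U V) :
  t = \sum_i \sum_j (t : 'M_(_, _)) i j *:
        ((vbasis {:U})`_i ⊗ (vbasis {:V})`_j).
Proof.
rewrite [LHS]matrix_sum_delta; apply: eq_bigr => i _; apply: eq_bigr => j _.
congr (_ *: _); apply/matrixP=> i' j'; rewrite !mxE.
rewrite !coord_free ?(basis_free (vbasisP _)) // -natrM mulnb.
by rewrite (eq_sym i) (eq_sym j).
Qed.

Lemma tens_hom_eq U V W (f g : 'Hom(tens U V, W)) :
  (forall u v, f (u ⊗ v) = g (u ⊗ v)) -> f = g.
Proof.
move=> fg; apply/lfunP => t; rewrite (tens_sum t) !linear_sum.
apply: eq_bigr => i _; rewrite !linear_sum; apply: eq_bigr => j _.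
by rewrite !linearZ /= fg.
Qed.

Lemma eq_tlift U V W (f g : U -> V -> W) :
  (forall u v, f u v = g u v) -> tlift f = tlift g.
Proof.
move=> fg; apply/lfunP => t; rewrite !lfunE /= /tsum.
by apply: eq_bigr => i _; apply: eq_bigr => j _; rewrite fg.
Qed.

Lemma linear_tlift U V W W' (f : U -> V -> W) (g : {linear W -> W'}) t :
  g (tlift f t) = tlift (fun u v => g (f u v)) t.
Proof.
rewrite !lfunE /= /tsum linear_sum; apply: eq_bigr => i _.
by rewrite linear_sum; apply: eq_bigr => j _; rewrite linearZ.
Qed.

Lemma tlift_app U V W W' (f : U -> V -> 'Hom(W, W')) t w :
  tlift f t w = tlift (fun u v => f u v w) t.
Proof.
rewrite !lfunE /= /tsum sum_lfunE; apply: eq_bigr => i _.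
by rewrite sum_lfunE; apply: eq_bigr => j _; rewrite scale_lfunE.
Qed.

Lemma memv_tlift U V W (f : U -> V -> W) t (X : {vspace W}) :
  (forall u v, f u v \in X) -> tlift f t \in X.
Proof.
move=> fX; rewrite lfunE; apply: memv_suml => i _; apply: memv_suml => j _.
exact: memvZ.
Qed.

Lemma exchange_tlift U V U' V' W (f : U -> V -> U' -> V' -> W) s t :
  tlift (fun a b => tlift (f a b) t) s =
  tlift (fun c d => tlift (fun a b => f a b c d) s) t.
Proof.
have sumE (X Y : vectType k) (g : X -> Y -> W) r : tlift g r = tsum g r by rewrite lfunE.
rewrite !sumE /tsum.
under eq_bigr => i _ do under eq_bigr => j _ do
  rewrite sumE /tsum scaler_sumr.
under [RHS]eq_bigr => i _ do under eq_bigr => j _ do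
  rewrite sumE /tsum scaler_sumr.
under eq_bigr => i _ do rewrite exchange_big.
rewrite exchange_big; apply: eq_bigr => i' _ /=.
under eq_bigr => i _ do under eq_bigr => j _ do rewrite scaler_sumr.
under [RHS]eq_bigr => j' _ do under eq_bigr => i _ do rewrite scaler_sumr.
under eq_bigr => i _ do rewrite exchange_big.
rewrite exchange_big; apply: eq_bigr => j' _ /=.
apply: eq_bigr => i _; apply: eq_bigr => j _.
by rewrite !scalerA mulrC.
Qed.

Lemma tlift_linear U V W (f g h : U -> V -> W) a t :
  (forall u v, f u v = a *: g u v + h u v) ->
  tlift f t = a *: tlift g t + tlift h t.
Proof.
move=> fgh; rewrite !lfunE /= /tsum scaler_sumr -big_split /=.
apply: eq_bigr => i _; rewrite scaler_sumr -big_split /=.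
by apply: eq_bigr => j _; rewrite fgh scalerDr !scalerA mulrC.
Qed.

Definition tmap U V U' V' (f : 'Hom(U, U')) (g : 'Hom(V, V')) :
  'Hom(tens U V, tens U' V') := tlift (fun u v => f u ⊗ g v).

Lemma tmap_bilin_arg U V U' V' (f : 'Hom(U, U')) (g : 'Hom(V, V')) :
  bilin (fun u v => f u ⊗ g v).
Proof.
have [l r] := pure_bilin U' V'.
by split=> [v|u] a x y; rewrite linearP (l, r).
Qed.

Lemma tmapE U V U' V' (f : 'Hom(U, U')) (g : 'Hom(V, V')) u v :
  tmap f g (u ⊗ v) = f u ⊗ g v.
Proof. exact/tliftE/tmap_bilin_arg. Qed.

(* The image of X ⊗ Y in the tensor product of the ambient spaces.            *)
Definition tensv U V (X : {vspace U}) (Y : {vspace V}) : {vspace tens U V} :=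
  limg (tmap (linfun (@vsval _ _ X)) (linfun (@vsval _ _ Y))).

Lemma tmap_bilin U V U' V' : bilin (@tmap U V U' V').
Proof.
by split=> [g a f f'|f a g g']; apply: tens_hom_eq => u v;
  rewrite add_lfunE scale_lfunE !tmapE add_lfunE scale_lfunE (purePl, purePr).
Qed.

Lemma tmap_comp U V U' V' U'' V'' (f : 'Hom(U, U')) (g : 'Hom(V, V'))
    (f' : 'Hom(U', U'')) (g' : 'Hom(V', V'')) :
  (tmap f' g' \o tmap f g)%VF = tmap (f' \o f)%VF (g' \o g)%VF.
Proof. by apply: tens_hom_eq => u v; rewrite comp_lfunE !tmapE !comp_lfunE. Qed.

Lemma tmap1 U V : tmap (\1%VF : 'End(U)) (\1%VF : 'End(V)) = \1%VF.
Proof. by apply: tens_hom_eq => u v; rewrite tmapE !id_lfunE. Qed.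

Lemma tlift_tmap U V U' V' W (f : 'Hom(U, U')) (g : 'Hom(V, V'))
    (h : U' -> V' -> W) t : bilin h ->
  tlift h (tmap f g t) = tlift (fun u v => h (f u) (g v)) t.
Proof.
move=> hb; rewrite -comp_lfunE; congr (fun_of_lfun _ t).
have [l r] := hb; apply: tens_hom_eq => u v; rewrite comp_lfunE tmapE !tliftE //.
by split=> [v'|u'] a x y; rewrite linearP (l, r).
Qed.

Definition tassoc U V W : 'Hom(tens (tens U V) W, tens U (tens V W)) :=
  tlift (fun t w => tlift (fun u v => u ⊗ (v ⊗ w)) t).

Lemma tassocE U V W (u : U) (v : V) (w : W) :
  tassoc U V W ((u ⊗ v) ⊗ w) = u ⊗ (v ⊗ w).
Proof.
have b w' : bilin (fun (u : U) (v : V) => u ⊗ (v ⊗ w' : tens V W)).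
  by split=> [x|x] a y z; rewrite ?purePl ?purePr.
rewrite tliftE ?tliftE //; split=> [x|t] a y z; first by rewrite linearP.
by apply: tlift_linear => u' v'; rewrite !purePr.
Qed.

Lemma tens3_hom_eq U V W W' (f g : 'Hom(tens (tens U V) W, W')) :
  (forall u v w, f ((u ⊗ v) ⊗ w) = g ((u ⊗ v) ⊗ w)) -> f = g.
Proof.
move=> fg; apply: tens_hom_eq => s w.
have l (h : 'Hom(tens (tens U V) W, W')) : linear (fun s => h (s ⊗ w)).
  by move=> a x y; rewrite purePl linearP.
rewrite -[LHS](linfunE (l f)) -[RHS](linfunE (l g)); congr (fun_of_lfun _ s).
by apply: tens_hom_eq => u v; rewrite (linfunE (l f)) (linfunE (l g)).
Qed.

Lemma tassoc_nat U V W U' V' W' (f : 'Hom(U, U')) (g : 'Hom(V, V'))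
    (h : 'Hom(W, W')) t :
  tassoc U' V' W' (tmap (tmap f g) h t) = tmap f (tmap g h) (tassoc U V W t).
Proof.
rewrite -!comp_lfunE; congr (fun_of_lfun _ t); apply: tens3_hom_eq => u v w.
by rewrite !comp_lfunE !(tmapE, tassocE).
Qed.

(* (a ⊗ b)(a' ⊗ b') = a a' ⊗ b b'.                                            *)
Definition tmul (A B : falgType k) (s t : tens A B) : tens A B :=
  tlift (fun a b => tmap (amull a) (amull b) t) s.

Lemma tmul_bilin (A B : falgType k) : bilin (@tmul A B).
Proof.
split=> [t|s] a x y; rewrite /tmul; first by rewrite linearP.
by apply: tlift_linear => u v; rewrite linearP.
Qed.

Lemma tmulE (A B : falgType k) (a a' : A) (b b' : B) :
  tmul (a ⊗ b) (a' ⊗ b') = (a * a') ⊗ (b * b').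
Proof.
have [l r] := tmap_bilin A B A B.
rewrite /tmul tliftE ?tmapE ?lfunE //.
by split=> [x|x] c y z; rewrite linearP (l, r) add_lfunE scale_lfunE.
Qed.

Definition lunit V : 'Hom(tens k^o V, V) := tlift (fun (c : k^o) v => c *: v).

Lemma lunitE V (c : k^o) v : lunit V (c ⊗ v) = c *: v.
Proof.
by rewrite tliftE //; split=> [x|x] a y z;
  rewrite ?scalerDl ?scalerDr ?scalerA // mulrC.
Qed.

Definition dual V : vectType k := 'Hom(V, k^o).

Definition dual_map V W (g : 'Hom(V, W)) : 'Hom(dual W, dual V) :=
  linfun (fun f : dual W => (f \o g)%VF).

Lemma dual_mapE V W (g : 'Hom(V, W)) f : dual_map g f = (f \o g)%VF.
Proof.
by apply: linfunE => a x y; rewrite comp_lfunDl comp_lfunZl.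
Qed.

End Tensor.

Notation "u ⊗ v" := (pure u v) (at level 40, left associativity).

(* V / N, carried by a complement of N; quot_pi is the canonical projection.  *)
Section Quotient.
Variables (k : fieldType) (V : vectType k).
Implicit Type N : {vspace V}.

Definition quot N : vectType k := subvs_of (N^C)%VS.

Definition quot_pi N : 'Hom(V, quot N) :=
  (linfun (@vsproj k V N^C) \o daddv_pi N^C N)%VF.

Lemma lker_quot_pi N : lker (quot_pi N) = N.
Proof.
have d : (N^C :&: N = 0)%VS by rewrite capvC capv_compl.
have e v : (v \in lker (quot_pi N)) = (daddv_pi N^C N v == 0).
  rewrite memv_ker comp_lfunE lfunE /= -(inj_eq (@subvs_inj _ _ _)) linear0.
  by rewrite vsprojK // memv_pi.
apply/vspaceP => v; rewrite e.
have dv : daddv_pi N^C N v + daddv_pi N N^C v = v.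
  by rewrite daddv_pi_add // addvC addv_complf memvf.
apply/eqP/idP => [v0|vN]; first by rewrite -dv v0 add0r memv_pi.
by move: dv; rewrite [in X in _ + X]daddv_pi_id ?capv_compl // => /(canRL (addrK _));
  rewrite subrr.
Qed.

Lemma limg_quot_pi N : limg (quot_pi N) = fullv.
Proof.
apply/vspaceP => q; rewrite memvf; apply/memv_imgP; exists (vsval q).
  exact: memvf.
by rewrite comp_lfunE lfunE /= daddv_pi_id ?vsvalK ?subvsP // capvC capv_compl.
Qed.

Lemma quot_piK N (q : quot N) : quot_pi N (vsval q) = q.
Proof.
by rewrite comp_lfunE lfunE /= daddv_pi_id ?vsvalK ?subvsP // capvC capv_compl.
Qed.

End Quotient.

Section QuotientMap.
Variables (k : fieldType) (V V' : vectType k).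
Variables (N : {vspace V}) (N' : {vspace V'}) (F : 'Hom(V, V')).

Definition quot_map : 'Hom(quot N, quot N') :=
  (quot_pi N' \o F \o linfun (@vsval k V N^C))%VF.

Lemma quot_mapE v : (F @: N <= N')%VS ->
  quot_map (quot_pi N v) = quot_pi N' (F v).
Proof.
move=> sFN; set w := vsval (quot_pi N v).
have -> : quot_map (quot_pi N v) = quot_pi N' (F w).
  by rewrite /w !comp_lfunE !lfunE.
have: w - v \in N.
  by rewrite -[in X in _ \in X](lker_quot_pi N) memv_ker linearB /= quot_piK subrr.
move/(memv_img F)/(subvP sFN); rewrite -[in X in _ \in X](lker_quot_pi N').
by rewrite memv_ker !linearB /= subr_eq0 => /eqP.
Qed.

End QuotientMap.

Section Representations.
Variables (k : fieldType) (A : falgType k).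
Implicit Types U V W : vectType k.

(* The space of linear maps V -> W that commute with two linear families of   *)
(* operators indexed by A; see homopP.                                        *)
Definition homop V W (rV : 'Hom(A, 'End(V))) (rW : 'Hom(A, 'End(W))) :
    {vspace 'Hom(V, W)} :=
  lker (linfun (fun f : 'Hom(V, W) =>
    linfun (fun a : A => ((f \o rV a) - (rW a \o f))%VF))).

Lemma homopP V W (rV : 'Hom(A, 'End(V))) (rW : 'Hom(A, 'End(W)))
    (f : 'Hom(V, W)) :
  reflect (forall a v, f (rV a v) = rW a (f v)) (f \in homop rV rW).
Proof.
have la (g : 'Hom(V, W)) : linear (fun a : A => ((g \o rV a) - (rW a \o g))%VF).
  move=> c x y; apply/lfunP => v; rewrite !linearP /=.
  by rewrite !(add_lfunE, opp_lfunE, scale_lfunE, comp_lfunE) !linearP /= scalerDr addrACA.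
have e : linfun (fun g : 'Hom(V, W) =>
    linfun (fun a : A => ((g \o rV a) - (rW a \o g))%VF)) f
    = linfun (fun a : A => ((f \o rV a) - (rW a \o f))%VF).
  apply: (linfunE (f := fun g => linfun (fun a : A => _))) => c x y.
  apply/lfunP => a; rewrite add_lfunE scale_lfunE !linfunE //.
  apply/lfunP => v; rewrite !(add_lfunE, opp_lfunE, scale_lfunE, comp_lfunE) !linearP /=.
  by rewrite scalerDr addrACA.
rewrite memv_ker e; apply: (iffP eqP) => [h a v|h].
  move/lfunP/(_ a): h; rewrite linfunE // zero_lfunE => /lfunP/(_ v)/eqP.
  rewrite add_lfunE opp_lfunE !comp_lfunE zero_lfunE subr_eq0 => /eqP.
  exact.
apply/lfunP => a; rewrite linfunE // zero_lfunE; apply/lfunP => v.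
by rewrite add_lfunE opp_lfunE !comp_lfunE zero_lfunE h subrr.
Qed.

Lemma homop_comp U V W (rU : 'Hom(A, 'End(U))) (rV : 'Hom(A, 'End(V)))
    (rW : 'Hom(A, 'End(W))) (g : 'Hom(V, W)) (f : 'Hom(U, V)) :
  f \in homop rU rV -> g \in homop rV rW -> (g \o f)%VF \in homop rU rW.
Proof.
by move=> /homopP hf /homopP hg; apply/homopP => a u; rewrite !comp_lfunE hf hg.
Qed.

Record rep := Rep {
  rep_sort :> vectType k;
  rho : 'Hom(A, 'End(rep_sort));
  rho1 : rho 1 = \1%VF;
  rhoM : forall a b, rho (a * b) = (rho a \o rho b)%VF }.

Definition homrep (V W : rep) : {vspace 'Hom(V, W)} := homop (rho V) (rho W).
Definition mor (V W : rep) : vectType k := subvs_of (homrep V W).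

Lemma mor_eq (V W : rep) (f : mor V W) a v :
  vsval f (rho V a v) = rho W a (vsval f v).
Proof. by have /homopP := subvsP f; apply. Qed.

Lemma mor1_subproof (V : rep) : (\1%VF : 'End(V)) \in homrep V V.
Proof. by apply/homopP => a v; rewrite !id_lfunE. Qed.
Definition mor1 (V : rep) : mor V V := Subvs (mor1_subproof V).

Lemma morc_subproof (U V W : rep) (g : mor V W) (f : mor U V) :
  (vsval g \o vsval f)%VF \in homrep U W.
Proof. by apply/homopP => a v; rewrite !comp_lfunE !mor_eq. Qed.
Definition morc (U V W : rep) (g : mor V W) (f : mor U V) : mor U W :=
  Subvs (morc_subproof g f).

(* The operators a |-> (f |-> f o r (s a)) on the dual space.                 *)
Definition dual_op V (s : 'End(A)) (r : 'Hom(A, 'End(V))) :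
    'Hom(A, 'End(dual V)) :=
  linfun (fun a => dual_map (r (s a))).

Lemma dual_opE V (s : 'End(A)) (r : 'Hom(A, 'End(V))) a (f : dual V) v :
  dual_op s r a f v = f (r (s a) v).
Proof.
rewrite linfunE; first by rewrite dual_mapE comp_lfunE.
move=> c x y; apply/lfunP => g; apply/lfunP => w.
by rewrite !linearP add_lfunE scale_lfunE /= !dual_mapE !lfunE /= !lfunE /= !lfunE /= linearP.
Qed.

End Representations.

(* k-linear functors between categories of finite-dimensional modules.        *)
Record repfunctor (k : fieldType) (A B : falgType k) := RepFunctor {
  fobj :> rep A -> rep B;
  fmap : forall V W, 'Hom(mor V W, mor (fobj V) (fobj W));
  fmap1 : forall V, fmap V V (mor1 V) = mor1 (fobj V);
  fmapc : forall U V W (g : mor V W) (f : mor U V),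
    fmap U W (morc g f) = morc (fmap V W g) (fmap U V f) }.

Arguments fmap {k A B} r {V W}.

Record hopfAlg (k : fieldType) := HopfAlg {
  hopf_sort :> falgType k;
  comul : 'Hom(hopf_sort, tens hopf_sort hopf_sort);
  counit : 'Hom(hopf_sort, k^o);
  antipode : 'End(hopf_sort);
  comulA : forall h, tassoc _ _ _ (tmap comul \1%VF (comul h))
                   = tmap \1%VF comul (comul h);
  counitl : forall h, tlift (fun a b => (counit a : k) *: b) (comul h) = h;
  counitr : forall h, tlift (fun a b => (counit b : k) *: a) (comul h) = h;
  comul1 : comul 1 = 1 ⊗ 1;
  comulM : forall g h, comul (g * h) = tmul (comul g) (comul h);
  counit1 : counit 1 = 1;
  counitM : forall g h, counit (g * h) = counit g * counit h;
  antipodel : forall h,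
    tlift (fun a b => antipode a * b) (comul h) = (counit h : k)%:A;
  antipoder : forall h,
    tlift (fun a b => a * antipode b) (comul h) = (counit h : k)%:A }.

Arguments comul {k} _.
Arguments counit {k} _.
Arguments antipode {k} _.

Record hopfSub (k : fieldType) (H : hopfAlg k) := HopfSub {
  hsub_aspace :> {aspace H};
  hsub1 : 1 \in hsub_aspace;
  hsub_comul : (comul H @: hsub_aspace <= tensv hsub_aspace hsub_aspace)%VS;
  hsub_antipode : (antipode H @: hsub_aspace <= hsub_aspace)%VS }.

Record comodAlg (k : fieldType) (H : hopfAlg k) := ComodAlg {
  comod_sort :> falgType k;
  coact : 'Hom(comod_sort, tens H comod_sort);
  coactA : forall x, tassoc _ _ _ (tmap (comul H) \1%VF (coact x))
                   = tmap \1%VF coact (coact x);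
  coactl : forall x, tlift (fun h y => (counit H h : k) *: y) (coact x) = x;
  coact1 : coact 1 = 1 ⊗ 1;
  coactM : forall x y, coact (x * y) = tmul (coact x) (coact y) }.

Arguments coact {k H} _.

Section ComoduleAlgebras.
Variables (k : fieldType) (H : hopfAlg k).
Implicit Type K : comodAlg H.

Definition Hsimple K := forall I : {vspace K},
  (forall x y, y \in I -> x * y \in I /\ y * x \in I) ->
  (coact K @: I <= tensv fullv I)%VS -> I = 0%VS \/ I = fullv.

Definition coinv K : {vspace K} :=
  lker (coact K - linfun (fun x : K => (1 : H) ⊗ x))%R.

Lemma coinvP K x : reflect (coact K x = 1 ⊗ x) (x \in coinv K).
Proof.
rewrite memv_ker !lfunE /= lfunE /= linfunE; last by move=> a y z; rewrite purePr.
by rewrite subr_eq0; apply: eqP.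
Qed.

Definition trivial_coinv K := coinv K = 1%VS.

(* H over itself; tens_rep over reg_comod is the tensor product of Rep(H).    *)
Definition reg_comod : comodAlg H :=
  ComodAlg (@comulA k H) (@counitl k H) (@comul1 k H) (@comulM k H).

(* x ⊗ m |-> k_(-1) x ⊗ k_(0) m, where d k = k_(-1) ⊗ k_(0).                  *)
Definition tens_op (A B : falgType k) (d : 'Hom(B, tens A B)) (X M : vectType k)
    (rX : 'Hom(A, 'End(X))) (rM : 'Hom(B, 'End(M))) : 'Hom(B, 'End(tens X M)) :=
  (tlift (fun a b => tmap (rX a) (rM b)) \o d)%VF.

Lemma tens_op_bilin (A B : falgType k) (X M : vectType k)
    (rX : 'Hom(A, 'End(X))) (rM : 'Hom(B, 'End(M))) :
  bilin (fun a b => tmap (rX a) (rM b)).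
Proof.
have [l r] := tmap_bilin X M X M.
by split=> [v|u] a x y; rewrite linearP (l, r).
Qed.

Lemma tens_rep1 K (X : rep H) (M : rep K) :
  tens_op (coact K) (rho X) (rho M) 1 = \1%VF.
Proof.
rewrite comp_lfunE coact1 tliftE; last exact: tens_op_bilin.
by rewrite !rho1 tmap1.
Qed.

Lemma tens_repM K (X : rep H) (M : rep K) x y :
  tens_op (coact K) (rho X) (rho M) (x * y) =
  (tens_op (coact K) (rho X) (rho M) x \o
   tens_op (coact K) (rho X) (rho M) y)%VF.
Proof.
rewrite !comp_lfunE coactM; set F := tlift _.
have FE : forall a b, F (a ⊗ b) = tmap (rho X a) (rho M b).
  exact/tliftE/tens_op_bilin.
pose P s t := F (tmul s t) = (F s \o F t)%VF.
have [ml mr] := tmul_bilin H K.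
have Pl t : (forall a b, P (a ⊗ b) t) -> forall s, P s t.
  move=> h s; rewrite /P.
  have -> : tmul s t = linfun (fun s => tmul s t) s.
    by rewrite (linfunE (ml t)).
  rewrite -comp_lfunE.
  have lt : linear (fun s => (F s \o F t)%VF).
    by move=> c u v; rewrite linearP comp_lfunDl comp_lfunZl.
  rewrite -[RHS](linfunE lt); congr (fun_of_lfun _ s).
  by apply: tens_hom_eq => a b; rewrite comp_lfunE (linfunE (ml t)) (linfunE lt) h.
have Pr s : (forall a b, P s (a ⊗ b)) -> forall t, P s t.
  move=> h t; rewrite /P.
  have -> : tmul s t = linfun (tmul s) t by rewrite (linfunE (mr s)).
  rewrite -comp_lfunE.
  have lt : linear (fun t => (F s \o F t)%VF).
    by move=> c u v; rewrite linearP comp_lfunDr comp_lfunZr.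
  rewrite -[RHS](linfunE lt); congr (fun_of_lfun _ t).
  by apply: tens_hom_eq => a b; rewrite comp_lfunE (linfunE (mr s)) (linfunE lt) h.
apply: Pl => a b; apply: Pr => a' b'.
by rewrite /P tmulE !FE !rhoM tmap_comp.
Qed.

Definition tens_rep K (X : rep H) (M : rep K) : rep K :=
  Rep (tens_rep1 X M) (tens_repM X M).

Lemma tens_repE K (X : rep H) (M : rep K) x (u : X) (m : M) :
  rho (tens_rep X M) x (u ⊗ m) =
  tlift (fun h y => rho X h u ⊗ rho M y m) (coact K x).
Proof.
rewrite /= comp_lfunE tlift_app; congr (fun_of_lfun _ _).
by apply: eq_tlift => h y; rewrite tmapE.
Qed.

Lemma tens_mor_subproof K (X Y : rep H) (M N : rep K) (f : mor X Y)
    (g : mor M N) :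
  tmap (vsval f) (vsval g) \in homrep (tens_rep X M) (tens_rep Y N).
Proof.
apply/homopP => x t; rewrite -!comp_lfunE; congr (fun_of_lfun _ t).
apply: tens_hom_eq => u m; rewrite [LHS]comp_lfunE [RHS]comp_lfunE.
rewrite tmapE !tens_repE linear_tlift.
by congr (fun_of_lfun _ _); apply: eq_tlift => h y /=; rewrite tmapE !mor_eq.
Qed.
Definition tens_mor K (X Y : rep H) (M N : rep K) (f : mor X Y) (g : mor M N) :
    mor (tens_rep X M) (tens_rep Y N) :=
  Subvs (tens_mor_subproof f g).

Lemma triv_linear : linear (fun h : H => (counit H h : k) *: (\1%VF : 'End(k^o))).
Proof. by move=> a x y; rewrite linearP scalerDl scalerA. Qed.

Lemma triv_rep1 :
  linfun (fun h : H => (counit H h : k) *: (\1%VF : 'End(k^o))) 1 = \1%VF.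
Proof. by rewrite (linfunE triv_linear) counit1 scale1r. Qed.

Lemma triv_repM (g h : H) :
  let r := linfun (fun h : H => (counit H h : k) *: (\1%VF : 'End(k^o))) in
  r (g * h) = (r g \o r h)%VF.
Proof.
rewrite /= !(linfunE triv_linear) counitM.
by rewrite -comp_lfunZl -comp_lfunZr comp_lfun1l scalerA.
Qed.

Definition triv_rep : rep H := Rep triv_rep1 triv_repM.

Lemma lunit_mor_subproof K (M : rep K) :
  lunit M \in homrep (tens_rep triv_rep M) M.
Proof.
apply/homopP => x t; rewrite -!comp_lfunE; congr (fun_of_lfun _ t).
apply: tens_hom_eq => c m; rewrite [LHS]comp_lfunE [RHS]comp_lfunE.
rewrite (@tens_repE K triv_rep M) lunitE linearZ /=.
have -> : rho M x m =
    tlift (fun h y => rho M ((counit H h : k) *: y) m) (coact K x).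
  by rewrite -[in LHS](coactl x) linear_tlift tlift_app.
rewrite [LHS]linear_tlift [RHS]linear_tlift.
congr (fun_of_lfun _ _); apply: eq_tlift => h y /=.
rewrite lunitE (linfunE triv_linear) scale_lfunE id_lfunE linearZ /=.
by rewrite scale_lfunE scalerA mulrC.
Qed.
Definition lunit_mor K (M : rep K) : mor (tens_rep triv_rep M) M :=
  Subvs (lunit_mor_subproof M).


End ComoduleAlgebras.

Section HopfSubalgebras.
Variables (k : fieldType) (H : hopfAlg k) (A : hopfSub H).

Local Notation B := (subvs_of A).

Definition hsub_inc : 'Hom(B, H) := linfun (@vsval _ _ A).
Definition hsub_proj : 'Hom(H, B) := linfun (@vsproj _ _ A).
Local Notation i := hsub_inc.
Local Notation p := hsub_proj.

Definition sub_comul : 'Hom(B, tens B B) := (tmap p p \o comul H \o i)%VF.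
Definition sub_counit : 'Hom(B, k^o) := (counit H \o i)%VF.
Definition sub_antipode : 'End(B) := (p \o antipode H \o i)%VF.

Lemma hsub_incE a : i a = vsval a. Proof. by rewrite lfunE. Qed.

Lemma hsub_incK : (p \o i)%VF = \1%VF.
Proof. by apply/lfunP => a; rewrite comp_lfunE !lfunE /= vsvalK. Qed.

Lemma tmap_inc_inj : injective (tmap i i).
Proof.
apply: (can_inj (g := tmap p p)) => t.
by rewrite -comp_lfunE tmap_comp hsub_incK tmap1 id_lfunE.
Qed.

Lemma sub_comulE a : tmap i i (sub_comul a) = comul H (i a).
Proof.
have: comul H (i a) \in tensv A A.
  by apply: (subvP (hsub_comul A)); rewrite memv_img // hsub_incE subvsP.
case/memv_imgP => t _ e; rewrite !comp_lfunE e.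
by rewrite -/i -[tmap p p _]comp_lfunE tmap_comp hsub_incK tmap1 id_lfunE.
Qed.

Lemma sub_antipodeE a : i (sub_antipode a) = antipode H (i a).
Proof.
rewrite !comp_lfunE /= [p _]lfunE hsub_incE /= vsprojK //.
by apply: (subvP (hsub_antipode A)); rewrite memv_img // hsub_incE subvsP.
Qed.

Lemma sub_counitE a : sub_counit a = counit H (i a).
Proof. exact: comp_lfunE. Qed.

Lemma hsub_inc1 : i 1 = 1.
Proof. by rewrite hsub_incE /=; apply/eqP; rewrite algid_eq1 hsub1. Qed.

Lemma hsub_incM a b : i (a * b) = i a * i b.
Proof. by rewrite !hsub_incE. Qed.

Lemma hsub_inc_inj : injective i.
Proof. by move=> a b; rewrite !hsub_incE => /subvs_inj. Qed.

Lemma sub_comulA h : tassoc _ _ _ (tmap sub_comul \1%VF (sub_comul h))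
                   = tmap \1%VF sub_comul (sub_comul h).
Proof.
have e : (tmap i i \o sub_comul)%VF = (comul H \o i)%VF.
  by apply/lfunP => a; rewrite comp_lfunE sub_comulE comp_lfunE.
have j : injective (tmap i (tmap i i)).
  apply: (can_inj (g := tmap p (tmap p p))) => t.
  by rewrite -comp_lfunE !tmap_comp hsub_incK !tmap1 id_lfunE.
apply: j; rewrite -tassoc_nat -!(comp_lfunE (tmap _ _)) !tmap_comp e.
rewrite comp_lfun1r.
have -> : tmap (comul H \o i) i = (tmap (comul H) \1 \o tmap i i)%VF.
  by rewrite tmap_comp comp_lfun1l.
have -> : tmap i (comul H \o i) = (tmap \1 (comul H) \o tmap i i)%VF.
  by rewrite tmap_comp comp_lfun1l.
by rewrite !(comp_lfunE (tmap _ _)) sub_comulE comulA.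
Qed.

Lemma inc_tlift (W : vectType k) (f : H -> H -> W) h : bilin f ->
  tlift (fun a b => f (i a) (i b)) (sub_comul h) = tlift f (comul H (i h)).
Proof. by move=> fb; rewrite -sub_comulE tlift_tmap. Qed.

Lemma sub_counitl h :
  tlift (fun a b => (sub_counit a : k) *: b) (sub_comul h) = h.
Proof.
apply: hsub_inc_inj; rewrite linear_tlift -[RHS](counitl (i h)) -inc_tlift.
  congr (fun_of_lfun _ _); apply: eq_tlift => a b /=.
  by rewrite linearZ comp_lfunE.
by split=> [x|x] a y z; rewrite linearP ?scalerDl ?scalerA // scalerA mulrC.
Qed.

Lemma sub_counitr h :
  tlift (fun a b => (sub_counit b : k) *: a) (sub_comul h) = h.
Proof.
apply: hsub_inc_inj; rewrite linear_tlift -[RHS](counitr (i h)) -inc_tlift.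
  congr (fun_of_lfun _ _); apply: eq_tlift => a b /=.
  by rewrite linearZ comp_lfunE.
by split=> [x|x] a y z; rewrite linearP ?scalerDl ?scalerA // scalerA mulrC.
Qed.

Lemma sub_comul1 : sub_comul 1 = 1 ⊗ 1.
Proof. by apply: tmap_inc_inj; rewrite sub_comulE tmapE hsub_inc1 comul1. Qed.

Lemma sub_comulM g h : sub_comul (g * h) = tmul (sub_comul g) (sub_comul h).
Proof.
apply: tmap_inc_inj; rewrite sub_comulE hsub_incM comulM -!sub_comulE.
rewrite /tmul [RHS]linear_tlift tlift_tmap; last first.
  have [l r] := tmap_bilin H H H H.
  by split=> [x|x] a y z; rewrite linearP (l, r) add_lfunE scale_lfunE.
congr (fun_of_lfun _ _); apply: eq_tlift => a b /=.
have e c : (amull (i c) \o i)%VF = (i \o amull c)%VF.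
  apply/lfunP => x; rewrite [LHS]comp_lfunE [RHS]comp_lfunE.
  by rewrite [amull _ _]lfunE /= [amull _ _]lfunE /= hsub_incM.
by rewrite -!comp_lfunE !tmap_comp !e.
Qed.

Lemma sub_counit1 : sub_counit 1 = 1.
Proof. by rewrite comp_lfunE hsub_inc1 counit1. Qed.

Lemma sub_counitM g h : sub_counit (g * h) = sub_counit g * sub_counit h.
Proof. by rewrite !comp_lfunE hsub_incM counitM. Qed.

Lemma sub_antipodel h :
  tlift (fun a b => sub_antipode a * b) (sub_comul h) = (sub_counit h : k)%:A.
Proof.
apply: hsub_inc_inj; rewrite linear_tlift linearZ /= hsub_inc1 sub_counitE.
rewrite -(antipodel (i h)) -inc_tlift; last first.
  by split=> x a y z; [rewrite linearP mulrDl -scalerAl|rewrite mulrDr -scalerAr].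
congr (fun_of_lfun _ _); apply: eq_tlift => a b /=.
by rewrite hsub_incM sub_antipodeE.
Qed.

Lemma sub_antipoder h :
  tlift (fun a b => a * sub_antipode b) (sub_comul h) = (sub_counit h : k)%:A.
Proof.
apply: hsub_inc_inj; rewrite linear_tlift linearZ /= hsub_inc1 sub_counitE.
rewrite -(antipoder (i h)) -inc_tlift; last first.
  by split=> x a y z; [rewrite mulrDl -scalerAl|rewrite linearP mulrDr -scalerAr].
congr (fun_of_lfun _ _); apply: eq_tlift => a b /=.
by rewrite hsub_incM sub_antipodeE.
Qed.

Definition sub_hopf : hopfAlg k :=
  HopfAlg sub_comulA sub_counitl sub_counitr sub_comul1 sub_comulM
    sub_counit1 sub_counitM sub_antipodel sub_antipoder.

Lemma res1 (X : rep H) : (rho X \o i)%VF 1 = \1%VF.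
Proof. by rewrite comp_lfunE hsub_inc1 rho1. Qed.

Lemma resM (X : rep H) a b :
  (rho X \o i)%VF (a * b) = ((rho X \o i)%VF a \o (rho X \o i)%VF b)%VF.
Proof. by rewrite !comp_lfunE hsub_incM rhoM. Qed.

Definition res (X : rep H) : rep sub_hopf :=
  @Rep k sub_hopf X (rho X \o i)%VF (res1 X) (resM X).

Lemma res_mor_subproof (X Y : rep H) (f : mor X Y) :
  vsval f \in homrep (res X) (res Y).
Proof. by apply/homopP => a v; rewrite /= !comp_lfunE mor_eq. Qed.
Definition res_mor (X Y : rep H) (f : mor X Y) : mor (res X) (res Y) :=
  Subvs (res_mor_subproof f).

End HopfSubalgebras.

Section Stabilizers.
Variables (k : fieldType) (H : hopfAlg k).

Definition convmul (g x : dual H) : dual H :=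
  (tlift (fun a b => (g a : k) * (x b : k) : k^o) \o comul H)%VF.

Lemma conv_bilin (g x : dual H) :
  bilin (fun a b => (g a : k) * (x b : k) : k^o).
Proof.
split=> v a y z; rewrite linearP; first by rewrite mulrDl -mulrA.
by rewrite mulrDr mulrCA.
Qed.

Lemma convmulE (g x : dual H) h :
  convmul g x h = tlift (fun a b => (g a : k) * (x b : k) : k^o) (comul H h).
Proof. exact: comp_lfunE. Qed.

Lemma convmul_bilin : bilin convmul.
Proof.
split=> [x|g] a y z; apply/lfunP => h; rewrite add_lfunE scale_lfunE !convmulE;
  apply: tlift_linear => u v; rewrite add_lfunE scale_lfunE.
  by rewrite mulrDl -mulrA.
by rewrite mulrDr mulrCA.
Qed.

(* Left multiplication by g in the algebra H^*.                               *)
Definition convl (g : dual H) : 'End(dual H) := linfun (convmul g).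

Lemma convlE g x : convl g x = convmul g x.
Proof. by apply: linfunE; have [_] := convmul_bilin. Qed.

(* <h . g, t> = <g, t h>                                                      *)
Definition hit : 'Hom(H, 'End(dual H)) := dual_op \1%VF (linfun (@amulr _ H)).

(* <h -> g, t> = <g, S^-1(h) t>.  Here and below, f^-1 is the linear          *)
(* right inverse of f on its image: it is the inverse of the antipode, which  *)
(* is bijective since H is finite-dimensional.                                *)
Definition harp : 'Hom(H, 'End(dual H)) :=
  dual_op (antipode H)^-1%VF (linfun (@amull _ H)).

Lemma hitE h g t : hit h g t = g (t * h).
Proof. by rewrite dual_opE id_lfunE !lfunE. Qed.

Lemma harpE h g t : harp h g t = g ((antipode H)^-1%VF h * t).
Proof. by rewrite dual_opE [linfun _ _]lfunE /= [amull _ _]lfunE. Qed.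

Variable K : comodAlg H.
Implicit Types V W : rep K.

Definition stab_op V : 'Hom(K, 'End(tens (dual H) V)) :=
  tens_op (coact K) harp (rho V).

Definition Lmap V W :
    'Hom(tens (dual H) 'Hom(V, W), 'Hom(tens (dual H) V, tens (dual H) W)) :=
  tlift (fun g f => tmap (convl g) f).

Definition stab V W : {vspace 'Hom(tens (dual H) V, tens (dual H) W)} :=
  (homop (stab_op V) (stab_op W) :&: limg (Lmap V W))%VS.

Lemma LmapE V W g (f : 'Hom(V, W)) : Lmap V W (g ⊗ f) = tmap (convl g) f.
Proof.
have [l r] := tmap_bilin (dual H) V (dual H) W; have [cl _] := convmul_bilin.
rewrite tliftE //; split=> [f'|g'] a x y; last by rewrite r.
rewrite -l; congr tmap; apply/lfunP => z.
by rewrite add_lfunE scale_lfunE !convlE cl.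
Qed.

Lemma convl_counit : convl (counit H) = \1%VF.
Proof.
apply/lfunP => x; rewrite convlE id_lfunE; apply/lfunP => h.
rewrite convmulE -[in RHS](counitl h) linear_tlift; congr (fun_of_lfun _ _).
by apply: eq_tlift => a b; rewrite /= linearZ.
Qed.

Lemma stab1_subproof V : \1%VF \in stab V V.
Proof.
rewrite memv_cap; apply/andP; split.
  by apply/homopP => x t; rewrite !id_lfunE.
apply/memv_imgP; exists (counit H ⊗ \1%VF); first exact: memvf.
by rewrite LmapE convl_counit tmap1.
Qed.
Definition stab1 V : subvs_of (stab V V) := Subvs (stab1_subproof V).

Lemma tmap_stab_op (V W : rep K) (h : mor V W) :
  tmap \1%VF (vsval h) \in homop (stab_op V) (stab_op W).
Proof.
apply/homopP => z t; rewrite -!comp_lfunE; congr (fun_of_lfun _ t).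
apply: tens_hom_eq => u m; rewrite [LHS]comp_lfunE [RHS]comp_lfunE.
rewrite tmapE ![stab_op _ _]comp_lfunE !tlift_app [LHS]linear_tlift.
congr (fun_of_lfun _ _); apply: eq_tlift => a b /=.
by rewrite !tmapE mor_eq !id_lfunE.
Qed.

Lemma stab_map_subproof V W V' W' (f : mor V' V) (g : mor W W')
    (x : subvs_of (stab V W)) :
  (tmap \1%VF (vsval g) \o vsval x \o tmap \1%VF (vsval f))%VF \in stab V' W'.
Proof.
have := subvsP x; rewrite !memv_cap => /andP[xop /memv_imgP[y _ xy]].
apply/andP; split.
  exact: homop_comp (tmap_stab_op f) (homop_comp xop (tmap_stab_op g)).
have l : linear (fun p : 'Hom(V, W) => (vsval g \o p \o vsval f)%VF).
  move=> a p q; apply/lfunP => v.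
  by rewrite !(add_lfunE, scale_lfunE, comp_lfunE) linearP.
apply/memv_imgP; exists (tmap \1%VF
  (linfun (fun p : 'Hom(V, W) => (vsval g \o p \o vsval f)%VF)) y).
  exact: memvf.
rewrite xy.
have l' : linear (fun z : 'Hom(tens (dual H) V, tens (dual H) W) =>
    (tmap \1%VF (vsval g) \o z \o tmap \1%VF (vsval f))%VF).
  move=> a p q; apply/lfunP => v.
  by rewrite !(add_lfunE, scale_lfunE, comp_lfunE) linearP.
rewrite -[LHS](linfunE l') -!comp_lfunE; congr (fun_of_lfun _ y).
apply: tens_hom_eq => u p; rewrite [LHS]comp_lfunE [RHS]comp_lfunE.
rewrite (linfunE l') tmapE !LmapE (linfunE l) id_lfunE !tmap_comp.
by rewrite comp_lfun1l comp_lfun1r.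
Qed.

(* Stab(f, g) : x |-> (id ⊗ g) o x o (id ⊗ f).                                *)
Definition stab_map V W V' W' (f : mor V' V) (g : mor W W')
    (x : subvs_of (stab V W)) : subvs_of (stab V' W') :=
  Subvs (stab_map_subproof f g x).

Lemma tlift_coassoc (X : vectType k) (G : H -> H -> H -> X) h :
  (forall b c, linear (fun a => G a b c)) ->
  (forall a c, linear (fun b => G a b c)) ->
  (forall a b, linear (fun c => G a b c)) ->
  tlift (fun a c => tlift (fun a1 a2 => G a1 a2 c) (comul H a)) (comul H h) =
  tlift (fun a1 b => tlift (fun a2 c => G a1 a2 c) (comul H b)) (comul H h).
Proof.
move=> l1 l2 l3.
have b2 a : bilin (G a) by split=> *; [apply: l2|apply: l3].
have b12 c : bilin (fun a b => G a b c) by split=> *; [apply: l1|apply: l2].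
have b3 : bilin (fun a => tlift (G a)).
  split=> [t|a] c x y; last by rewrite linearP.
  by apply: tlift_linear => u v; rewrite l1.
pose T := tlift (fun a => tlift (G a)).
have TE a b c : T (a ⊗ (b ⊗ c)) = G a b c by rewrite /T !tliftE.
have Ta s : T (tassoc H H H s) =
    tlift (fun t c => tlift (fun a b => G a b c) t) s.
  rewrite -(comp_lfunE T); congr (fun_of_lfun _ s).
  apply: tens3_hom_eq => a b c; rewrite comp_lfunE tassocE TE tliftE ?tliftE //.
  split=> [c'|t] e x y; first by rewrite linearP.
  by apply: tlift_linear => u v; rewrite l3.
have := congr1 T (comulA h); rewrite Ta.
rewrite [X in X = _]tlift_tmap; last first.
  split=> [c'|t] e x y; first by rewrite linearP.
  by apply: tlift_linear => u v; rewrite l3.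
rewrite [X in _ = X]tlift_tmap //.
have e : tlift (fun a c => tlift (fun a1 a2 => G a1 a2 (\1%VF c)) (comul H a))
       = tlift (fun a c => tlift (fun a1 a2 => G a1 a2 c) (comul H a)).
  by apply: eq_tlift => a c; rewrite id_lfunE.
have e' : tlift (fun a c => tlift (G (\1%VF a)) (comul H c))
       = tlift (fun a c => tlift (G a) (comul H c)).
  by apply: eq_tlift => a c; rewrite id_lfunE.
by rewrite e e'.
Qed.

Lemma hit_convmul h (g x : dual H) :
  convmul (hit h g) x =
  tlift (fun a b => hit a (convmul g (hit (antipode H b) x))) (comul H h).
Proof.
apply/lfunP => t; have appE (f : H -> H -> dual H) s :
    tlift f s t = tlift (fun u v => f u v t : k^o) s.
  exact: tlift_app.
rewrite appE convmulE.
transitivity (tlift (fun a b => tlift (fun t1 t2 => tlift (fun a1 a2 =>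
   (g (t1 * a1) : k) * (x (t2 * (a2 * antipode H b)) : k) : k^o)
   (comul H a)) (comul H t)) (comul H h)); last first.
  congr (fun_of_lfun _ _); apply: eq_tlift => a b.
  rewrite hitE convmulE comulM /tmul linear_tlift.
  congr (fun_of_lfun _ _); apply: eq_tlift => t1 t2.
  rewrite [RHS]tlift_tmap; last exact: conv_bilin.
  congr (fun_of_lfun _ _); apply: eq_tlift => a1 a2.
  by rewrite hitE ![amull _ _]lfunE /= mulrA.
rewrite exchange_tlift; congr (fun_of_lfun _ _); apply: eq_tlift => t1 t2.
pose G a1 a2 b : k^o := (g (t1 * a1) : k) * (x (t2 * (a2 * antipode H b)) : k).
rewrite (@tlift_coassoc _ G).
- have l : linear (fun s : H => (g (t1 * s) : k) * (x t2 : k) : k^o).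
    move=> c y z; rewrite mulrDr -scalerAr linearP mulrDl.
    by rewrite -mulrA.
  transitivity (linfun (fun s : H => (g (t1 * s) : k) * (x t2 : k) : k^o)
     (tlift (fun a b => (counit H b : k) *: a) (comul H h))).
    by rewrite counitr (linfunE l) hitE.
  rewrite linear_tlift.
  congr (fun_of_lfun _ _); apply: eq_tlift => a1 c /=.
  rewrite (linfunE l).
  have l' : linear (fun s : H => (g (t1 * a1) : k) * (x (t2 * s) : k) : k^o).
    move=> e y z; rewrite mulrDr -scalerAr linearP mulrDr mulrCA.
    by [].
  transitivity (linfun (fun s : H => (g (t1 * a1) : k) * (x (t2 * s) : k) : k^o)
     (tlift (fun a2 b => a2 * antipode H b) (comul H c))).
    rewrite antipoder (linfunE l') -!scalerAr mulr1 !linearZ /=.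
    by rewrite -mulrA mulrCA.
  rewrite linear_tlift; congr (fun_of_lfun _ _); apply: eq_tlift => a2 b /=.
  by rewrite (linfunE l').
- move=> b c e y z; rewrite /G mulrDr -scalerAr linearP mulrDl.
  by rewrite -mulrA.
- move=> b c e y z; rewrite /G mulrDl -scalerAl mulrDr -scalerAr linearP.
  by rewrite mulrDr mulrCA.
- move=> b c e y z; rewrite /G linearP !mulrDr -!scalerAr linearP.
  by rewrite mulrDr mulrCA.
Qed.

Lemma Lmap_hit V W h y :
  Lmap V W (tmap (hit h) \1%VF y) =
  tlift (fun a b => (tmap (hit a) \1%VF \o Lmap V W y \o
                     tmap (hit (antipode H b)) \1%VF)%VF) (comul H h).
Proof.
pose C (z : 'Hom(tens (dual H) V, tens (dual H) W)) :=
  tlift (fun a b => (tmap (hit a) \1%VF \o z \o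
                     tmap (hit (antipode H b)) \1%VF)%VF) (comul H h).
have l : linear C.
  move=> c z z'; apply: tlift_linear => a b; apply/lfunP => v.
  by rewrite !(add_lfunE, scale_lfunE, comp_lfunE) linearP.
rewrite -[RHS]/(C (Lmap V W y)) -[RHS](linfunE l) -!comp_lfunE.
congr (fun_of_lfun _ y); apply: tens_hom_eq => g f.
rewrite [LHS]comp_lfunE [RHS]comp_lfunE (linfunE l) /C tmapE !LmapE id_lfunE.
apply: tens_hom_eq => x v; rewrite tmapE convlE hit_convmul.
have appE (P Q : vectType k) (F : H -> H -> 'Hom(P, Q)) s w :
    tlift F s w = tlift (fun u v => F u v w) s by exact: tlift_app.
rewrite appE.
have lv : linear (fun z : dual H => z ⊗ f v) by move=> c z z'; rewrite purePl.
rewrite -[LHS](linfunE lv) linear_tlift.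
congr (fun_of_lfun _ _); apply: eq_tlift => a b /=.
by rewrite (linfunE lv) [RHS]comp_lfunE [in RHS]comp_lfunE !tmapE !id_lfunE convlE.
Qed.

Lemma hit_stab_op V h :
  tmap (hit h) \1%VF \in homop (stab_op V) (stab_op V).
Proof.
apply/homopP => z t; rewrite -!comp_lfunE; congr (fun_of_lfun _ t).
apply: tens_hom_eq => u m; rewrite [LHS]comp_lfunE [RHS]comp_lfunE.
rewrite tmapE ![stab_op _ _]comp_lfunE !tlift_app [LHS]linear_tlift.
congr (fun_of_lfun _ _); apply: eq_tlift => a b /=.
rewrite !tmapE !id_lfunE; congr pure; apply/lfunP => s.
by rewrite !(hitE, harpE) mulrA.
Qed.

Lemma stab_act_subproof V W h (x : subvs_of (stab V W)) :
  Lmap V W (tmap (hit h) \1%VF ((Lmap V W)^-1%VF (vsval x))) \in stab V W.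
Proof.
have := subvsP x; rewrite !memv_cap => /andP[xop xL].
rewrite memv_img ?memvf // andbT Lmap_hit limg_lfunVK //.
apply: memv_tlift => a b.
exact: homop_comp (hit_stab_op _ _) (homop_comp xop (hit_stab_op _ _)).
Qed.

(* h . (sum g_i ⊗ f_i) = sum (h . g_i) ⊗ f_i.                                 *)
Definition stab_act V W h (x : subvs_of (stab V W)) : subvs_of (stab V W) :=
  Subvs (stab_act_subproof h x).

Lemma stab_actE V W h (x : subvs_of (stab V W)) y : vsval x = Lmap V W y ->
  vsval (stab_act h x) = Lmap V W (tmap (hit h) \1%VF y).
Proof.
move=> xy; rewrite /= !Lmap_hit limg_lfunVK ?xy //.
by rewrite memv_img ?memvf.
Qed.

End Stabilizers.

Section Induction.
Variables (k : fieldType) (H : hopfAlg k) (A : hopfSub H).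

Section Object.
Variables (U : vectType k) (r : 'Hom(sub_hopf A, 'End(U))).

Definition ind_rel : {vspace tens H U} :=
  limg (tlift (fun (h : H) (t : tens (sub_hopf A) U) =>
    tlift (fun (a : sub_hopf A) u => (h * hsub_inc A a) ⊗ u - h ⊗ r a u) t)).

(* H ⊗_A U.                                                                   *)
Definition ind : vectType k := quot ind_rel.
Definition ind_cl (h : H) (u : U) : ind := quot_pi ind_rel (h ⊗ u).

Definition ind_op : 'Hom(H, 'End(ind)) :=
  linfun (fun h => quot_map ind_rel ind_rel (tmap (amull h) \1%VF)).

Lemma ind_rel_bilin : bilin (fun (h : H) (t : tens (sub_hopf A) U) =>
  tlift (fun (a : sub_hopf A) u => (h * hsub_inc A a) ⊗ u - h ⊗ r a u) t).
Proof.
split=> [t|h] c x y; last by rewrite linearP.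
apply: tlift_linear => a u; rewrite mulrDl -scalerAl !purePl.
by rewrite scalerBr opprD addrACA.
Qed.

Lemma ind_rel_bilin2 h : bilin (fun (a : sub_hopf A) u =>
  (h * hsub_inc A a) ⊗ u - h ⊗ r a u).
Proof.
split=> [u|a] c x y.
  rewrite !linearP /= mulrDr -scalerAr purePl add_lfunE scale_lfunE purePr.
  by rewrite scalerBr opprD addrACA.
by rewrite linearP !purePr scalerBr opprD addrACA.
Qed.

Lemma ind_clM h (a : sub_hopf A) u :
  ind_cl (h * hsub_inc A a) u = ind_cl h (r a u).
Proof.
apply/eqP; rewrite -subr_eq0 -linearB -memv_ker lker_quot_pi.
apply/memv_imgP; exists (h ⊗ (a ⊗ u)); first exact: memvf.
by rewrite (tliftE ind_rel_bilin) (tliftE (ind_rel_bilin2 h)).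
Qed.

End Object.

Lemma ind_rel_sub (U U' : vectType k) (r : 'Hom(sub_hopf A, 'End(U)))
    (r' : 'Hom(sub_hopf A, 'End(U'))) h (F : 'Hom(U, U')) :
  F \in homop r r' -> (tmap (amull h) F @: ind_rel r <= ind_rel r')%VS.
Proof.
move=> /homopP Fr; apply/subvP => _ /memv_imgP[_ /memv_imgP[t _ ->] ->].
apply/memv_imgP; exists (tmap (amull h) (tmap \1%VF F) t); first exact: memvf.
rewrite -!comp_lfunE; congr (fun_of_lfun _ t); apply: tens_hom_eq => z s.
rewrite [LHS]comp_lfunE [RHS]comp_lfunE tmapE.
rewrite (tliftE (ind_rel_bilin r)) (tliftE (ind_rel_bilin r')).
rewrite tlift_tmap; last exact: ind_rel_bilin2.
rewrite [LHS]linear_tlift; congr (fun_of_lfun _ _); apply: eq_tlift => a u /=.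
by rewrite linearB /= !tmapE id_lfunE Fr ![amull _ _]lfunE /= mulrA.
Qed.

Lemma ind_opE (U : vectType k) (r : 'Hom(sub_hopf A, 'End(U))) h z u :
  ind_op r h (ind_cl r z u) = ind_cl r (h * z) u.
Proof.
have id_r : \1%VF \in homop r r by apply/homopP => a v; rewrite !id_lfunE.
rewrite linfunE.
  by rewrite quot_mapE ?ind_rel_sub // tmapE id_lfunE [amull _ _]lfunE.
move=> c x y; apply/lfunP => q.
rewrite -(quot_piK q) add_lfunE scale_lfunE !quot_mapE ?ind_rel_sub //.
have [l _] := tmap_bilin H U H U.
by rewrite linearP l add_lfunE scale_lfunE linearP.
Qed.

Definition ind_map (U U' : vectType k) (r : 'Hom(sub_hopf A, 'End(U)))
    (r' : 'Hom(sub_hopf A, 'End(U'))) (F : 'Hom(U, U')) :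
    'Hom(ind r, ind r') :=
  quot_map (ind_rel r) (ind_rel r') (tmap \1%VF F).

Lemma ind_mapE (U U' : vectType k) (r : 'Hom(sub_hopf A, 'End(U)))
    (r' : 'Hom(sub_hopf A, 'End(U'))) (F : 'Hom(U, U')) h u :
  F \in homop r r' -> ind_map r r' F (ind_cl r h u) = ind_cl r' h (F u).
Proof.
by move=> Fr; rewrite quot_mapE ?tmapE ?id_lfunE // -amull1 ind_rel_sub.
Qed.

(* (H ⊗_A U)^* with (h . alpha)(z) = alpha(S(h) z).                           *)
Definition dual_ind_op (U : vectType k) (r : 'Hom(sub_hopf A, 'End(U))) :
    'Hom(H, 'End(dual (ind r))) :=
  dual_op (antipode H) (ind_op r).

(* The action of A on V ⊗ W^*, where (a . f)(w) = f(S^-1(a) w).               *)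
Definition tensdual_op (V W : rep (sub_hopf A)) :
    'Hom(sub_hopf A, 'End(tens V (dual W))) :=
  tens_op (comul (sub_hopf A)) (rho V)
    (dual_op (antipode (sub_hopf A))^-1%VF (rho W)).

Lemma tensdual_map (V V' W W' : rep (sub_hopf A)) (f : mor V' V) (g : mor W W') :
  tmap (vsval f) (dual_map (vsval g)) \in
    homop (tensdual_op V' W') (tensdual_op V W).
Proof.
apply/homopP => z t; rewrite -!comp_lfunE; congr (fun_of_lfun _ t).
apply: tens_hom_eq => u m; rewrite [LHS]comp_lfunE [RHS]comp_lfunE.
rewrite tmapE ![tensdual_op _ _ _]comp_lfunE !tlift_app [LHS]linear_tlift.
congr (fun_of_lfun _ _); apply: eq_tlift => a b /=.
rewrite !tmapE mor_eq; congr pure; apply/lfunP => w.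
by rewrite !dual_mapE comp_lfunE !dual_opE comp_lfunE mor_eq.
Qed.

End Induction.

Section DynamicalData.
Variables (k : fieldType) (H : hopfAlg k) (A : hopfSub H) (K : comodAlg H).
Variable T : repfunctor (sub_hopf A) K.

Definition stab_iso (w : forall V W : rep (sub_hopf A),
    'Hom(subvs_of (stab (T V) (T W)), dual (ind (tensdual_op V W)))) : Prop :=
  [/\ forall V W, bijective (w V W),
      forall V W h x,
        w V W (stab_act h x) = dual_ind_op (tensdual_op V W) h (w V W x),
      forall V W V' W' (f : mor V' V) (g : mor W W') x,
        w V' W' (stab_map (fmap T f) (fmap T g) x) =
        (w V W x \o ind_map (tensdual_op V' W') (tensdual_op V W)
                      (tmap (vsval f) (dual_map (vsval g))))%VF
    & forall (V : rep (sub_hopf A)) h (v : V) (f : dual V),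
        w V V (stab1 (T V)) (ind_cl (tensdual_op V V) h (v ⊗ f)) =
        counit H h * f v].

Definition dynamical_datum : Prop :=
  [/\ Hsimple K, trivial_coinv K & exists w, stab_iso w].

(* The first isomorphism is defined over K, the second one over A; in the     *)
(* last clause R(k) = k, both unit isomorphisms being c ⊗ v |-> c v.          *)
Definition dynamical_adjoint : Prop :=
  exists xi : forall (X : rep H) (V W : rep (sub_hopf A)),
    'Hom(mor (tens_rep X (T V)) (T W),
         mor (tens_rep (K := reg_comod (sub_hopf A)) (res A X) V) W),
  [/\ forall X V W, bijective (xi X V W),
      forall X X' V V' W W' (p : mor X' X) (f : mor V' V) (g : mor W W')
          (u : mor (tens_rep X (T V)) (T W)),
        xi X' V' W' (morc (fmap T g) (morc u (tens_mor p (fmap T f)))) =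
        morc g (morc (xi X V W u)
          (tens_mor (K := reg_comod (sub_hopf A)) (res_mor A p) f))
    & forall V, vsval (xi (triv_rep H) V V (lunit_mor (T V))) = lunit V].

End DynamicalData.

(* Main.v *)
Require Import Defs.
From mathcomp Require Import all_boot all_algebra all_field.
Set Implicit Arguments.
Unset Strict Implicit.
Unset Printing Implicit Defensive.
Import GRing.Theory.
Local Open Scope ring_scope.

(** Write S for the antipode.  The map xi is a composite of three natural
    isomorphisms
      Hom_K(X ⊗ T(V), T(W)) = Hom_H(X, Stab_K(T(V), T(W)))
                            = Hom_H(X, (Ind (V ⊗ W^* ))^* )
                            = Hom_A(X ⊗ V, W),
    in which the middle one is composition with the given isomorphism w.

    The first one says that the stabilizer is the internal Hom of K-modules.
    Under H^* ⊗ Hom(V, W) = Hom(H, Hom(V, W)), an element of the stabilizer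
    becomes a family F_t : V -> W, linear in t in H, and the operator that it
    induces on H^* ⊗ V -> H^* ⊗ W, evaluated at t, is
      xi ⊗ v |-> sum xi(t_2) F_{t_1}(v).
    This operator commutes with K if and only if
      sum F_{x_(-1) t}(x_(0) v) = x F_t(v)  for all x in K,
    i.e. if and only if F is K-linear on H ⊗ V (stabP).  A K-linear map u
    therefore yields for every x in X the element t |-> u(t x ⊗ -) of the
    stabilizer (orbit_stab), H-linearly in x, and u is recovered at t = 1.

    For the last one, an H-linear phi : X -> (H ⊗_A U)^* is determined by its
    values on the classes of 1 ⊗ u, since phi(x)(h ⊗ u) = phi(S^-1(h) x)(1 ⊗ u)
    (equivariant_cl).  For U = V ⊗ W^* these values form a map G : X ⊗ V -> W,
    and the relations of H ⊗_A U turn into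
      sum S^-1(a_2) G(x ⊗ a_1 v) = G(S^-1(a) x ⊗ v)  for all a in A,
    which is another way of saying that G is A-linear (moved_left_homrep).

    All of this uses that S is bijective, on H and on A, which for a
    finite-dimensional Hopf algebra is a theorem of Larson and Sweedler.  It is
    proved here from a nonzero left integral L.  Such an L exists because the
    coevaluation embeds the trivial module into H ⊗ H^*, which is a free module
    (exists_integral).  Invariance of L gives
      sum L_1 ⊗ S(L_2) g = sum g L_1 ⊗ S(L_2),
    so that the elements sum chi(L_1) S(L_2) g all lie in the image of S, and
    every multiple chi(L) h is a sum of such elements (limg_antipode). *)

(** * Linearity of composite expressions *)

Section Linearity.
Variable k : fieldType.
Implicit Types U V W X : vectType k.

Lemma lin_id U : linear (fun x : U => x). Proof. by []. Qed.

Lemma lin_comp U V W (f : 'Hom(V, W)) (g : U -> V) :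
  linear g -> linear (fun x => f (g x)).
Proof. by move=> lg a x y; rewrite lg linearP. Qed.

Lemma lin_app U V W (f : U -> 'Hom(V, W)) v :
  linear f -> linear (fun x => f x v).
Proof. by move=> lf a x y; rewrite lf add_lfunE scale_lfunE. Qed.

Lemma lin_scalel U V (f : U -> k^o) (v : V) :
  linear f -> linear (fun x => (f x : k) *: v).
Proof. by move=> lf a x y; rewrite lf scalerDl scalerA. Qed.

Lemma lin_scaler U V (f : U -> V) (c : k) :
  linear f -> linear (fun x => c *: f x).
Proof. by move=> lf a x y; rewrite lf scalerDr !scalerA mulrC. Qed.

Lemma lin_mull U (B : falgType k) (f : U -> B) c :
  linear f -> linear (fun x => f x * c).
Proof. by move=> lf a x y; rewrite lf mulrDl scalerAl. Qed.

Lemma lin_mulr U (B : falgType k) (f : U -> B) c :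
  linear f -> linear (fun x => c * f x).
Proof. by move=> lf a x y; rewrite lf mulrDr scalerAr. Qed.

Lemma lin_purel U V W (f : U -> V) (w : W) :
  linear f -> linear (fun x => f x ⊗ w).
Proof. by move=> lf a x y; rewrite lf purePl. Qed.

Lemma lin_purer U V W (f : U -> W) (v : V) :
  linear f -> linear (fun x => v ⊗ f x).
Proof. by move=> lf a x y; rewrite lf purePr. Qed.

Lemma lin_tlift U V W X (f : U -> V -> W -> X) t :
  (forall v w, linear (fun x => f x v w)) -> linear (fun x => tlift (f x) t).
Proof. by move=> lf a x y; apply: tlift_linear => v w; rewrite lf. Qed.

Lemma lin_linfun U V W (f : U -> V -> W) :
  (forall x, linear (f x)) -> (forall v, linear (fun x => f x v)) ->
  linear (fun x => linfun (f x)).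
Proof.
move=> l l' a x y; apply/lfunP=> v.
by rewrite add_lfunE scale_lfunE !(linfunE (l _)) l'.
Qed.

Lemma lin_sum U V (I : finType) (f : U -> I -> V) :
  (forall i, linear (f^~ i)) -> linear (fun x => \sum_i f x i).
Proof.
move=> lf a x y; rewrite scaler_sumr -big_split.
by apply: eq_bigr => i _; rewrite /= lf.
Qed.

End Linearity.

(** Maps built from sums over coproducts are given by bare functions, so each
    use of a universal property asks for the linearity of a nested expression.
    This tactic derives it from the syntax.  The matching is not lazy: a pattern
    variable such as ?v may capture the bound variable, in which case apply
    fails and the next clause is tried. *)
Ltac lin_step :=
  match goal with
  | |- bilin _ => split; (let x := fresh "x" in intro x)
  | |- forall _, GRing.linear_for _ _ => let x := fresh "x" in intro x
  | |- forall _ _, GRing.linear_for _ _ =>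
    let x := fresh "x" in let y := fresh "y" in intros x y
  | |- GRing.linear_for _ (fun x => x) => exact: lin_id
  | |- GRing.linear_for _ (fun_of_lfun _) => exact: linearP
  | |- GRing.linear_for _ (GRing.mul _) => exact/lin_mulr/lin_id
  | |- GRing.linear_for _ (fun x => fun_of_lfun (tlift _) ?t) => apply: lin_tlift
  | |- GRing.linear_for _ (fun x => fun_of_lfun (@?f x) ?v) =>
    apply: (@lin_app _ _ _ _ f v)
  | |- GRing.linear_for _ (fun x => fun_of_lfun ?f (@?v x)) =>
    apply: (@lin_comp _ _ _ _ f v)
  | |- GRing.linear_for _ (fun x => linfun _) => apply: lin_linfun
  | |- GRing.linear_for _ (fun x => @?f x *: ?v) => apply: (@lin_scalel _ _ _ f v)
  | |- GRing.linear_for _ (fun x => ?c *: @?f x) => apply: (@lin_scaler _ _ _ f c)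
  | |- GRing.linear_for _ (fun x => @?f x * ?c) => apply: (@lin_mull _ _ _ f c)
  | |- GRing.linear_for _ (fun x => ?c * @?f x) => apply: (@lin_mulr _ _ _ f c)
  | |- GRing.linear_for _ (fun x => pure (@?f x) ?c) =>
    apply: (@lin_purel _ _ _ _ f c)
  | |- GRing.linear_for _ (fun x => pure ?c (@?f x)) =>
    apply: (@lin_purer _ _ _ _ f c)
  | |- GRing.linear_for _ (fun x => \sum_i _) => apply: lin_sum
  end; cbv beta.
Ltac lin := cbv beta; repeat lin_step; try done.

(** * Sums over coproducts *)

Section Sweedler.
Variable k : fieldType.
Implicit Types U V W X : vectType k.

Lemma eq_tlift_at U V W (f g : U -> V -> W) t :
  (forall u v, f u v = g u v) -> tlift f t = tlift g t.
Proof. by move=> fg; rewrite (eq_tlift fg). Qed.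

Lemma tlift_push U V W X (G : W -> X) (f : U -> V -> W) t : linear G ->
  G (tlift f t) = tlift (fun u v => G (f u v)) t.
Proof.
move=> lG; rewrite -(linfunE lG) linear_tlift; apply: eq_tlift_at => u v.
exact: linfunE.
Qed.

Lemma scaler_tlift U V W c (f : U -> V -> W) t :
  c *: tlift f t = tlift (fun u v => c *: f u v) t.
Proof. by apply: (@tlift_push _ _ _ _ ( *:%R c)); apply: lin_scaler. Qed.

Lemma tlift_scalel U V W (f : U -> V -> k^o) (w : W) t :
  tlift (fun u v => (f u v : k) *: w) t = (tlift f t : k) *: w.
Proof.
by rewrite (@tlift_push _ _ _ _ (fun c : k^o => (c : k) *: w)) //; apply: lin_scalel.
Qed.

Lemma sum_tlift U V W (I : finType) (f : I -> U -> V -> W) t :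
  \sum_i tlift (f i) t = tlift (fun u v => \sum_i f i u v) t.
Proof.
under eq_bigr => i _ do rewrite lfunE /= /tsum.
rewrite lfunE /= /tsum exchange_big; apply: eq_bigr => a _ /=.
rewrite exchange_big; apply: eq_bigr => b _ /=.
by rewrite scaler_sumr.
Qed.

Lemma mulr_tlift U V (B : falgType k) c (f : U -> V -> B) t :
  c * tlift f t = tlift (fun u v => c * f u v) t.
Proof. by apply: (@tlift_push _ _ _ _ ( *%R c)); apply: lin_mulr. Qed.

Lemma mull_tlift U V (B : falgType k) c (f : U -> V -> B) t :
  tlift f t * c = tlift (fun u v => f u v * c) t.
Proof. by apply: (@tlift_push _ _ _ _ ( *%R^~ c)); apply: lin_mull. Qed.

Lemma pureZr U V c (u : U) (v : V) : u ⊗ (c *: v) = c *: (u ⊗ v).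
Proof.
have l : linear (fun v : V => u ⊗ v) by lin.
by rewrite -!(linfunE l) linearZ.
Qed.

Variable H : hopfAlg k.
Variable K : comodAlg H.
Implicit Types (g h : H) (x : K).

(** Coassociativity as a rule for moving an inner sum: with G trilinear,
    both sides are the sum of G(x_(-2), x_(-1), x_(0)). *)
Lemma coact_coassoc X (G : H -> H -> K -> X) x :
  (forall b y, linear (fun a => G a b y)) ->
  (forall a y, linear (fun b => G a b y)) ->
  (forall a b, linear (G a b)) ->
  tlift (fun h y => tlift (fun a b => G a b y) (comul H h)) (coact K x) =
  tlift (fun a z => tlift (fun b y => G a b y) (coact K z)) (coact K x).
Proof.
move=> l1 l2 l3; pose T := tlift (fun a => tlift (G a)).
have bG y : bilin (fun a b => G a b y) by split=> *; [exact: l1|exact: l2].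
have bGr a : bilin (G a) by split=> *; [exact: l2|exact: l3].
have bT : bilin (fun a => tlift (G a)).
  split=> [t|a]; last exact: linearP.
  by apply: lin_tlift => u v; exact: l1.
have bA : bilin (fun s y => tlift (fun a b => G a b y) s).
  split=> [y|s]; first exact: linearP.
  by apply: lin_tlift => u v; exact: l3.
have TA : (T \o tassoc H H K)%VF = tlift (fun s y => tlift (fun a b => G a b y) s).
  apply: tens3_hom_eq => a b y.
  by rewrite comp_lfunE tassocE [LHS]tliftE // [LHS]tliftE // [RHS]tliftE // tliftE.
have := congr1 T (coactA x); rewrite -(comp_lfunE T (tassoc _ _ _)) TA !tlift_tmap // => e.
etransitivity; first by etransitivity; last exact: e;
  apply: eq_tlift_at => a y; rewrite id_lfunE.
by apply: eq_tlift_at => a y; rewrite id_lfunE.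
Qed.

Lemma coact_counit X (F : K -> X) x : linear F ->
  tlift (fun h y => (counit H h : k) *: F y) (coact K x) = F x.
Proof.
move=> lF; rewrite -[in RHS](coactl x) (tlift_push _ _ lF).
by apply: eq_tlift_at => h y; rewrite -!(linfunE lF) linearZ.
Qed.

End Sweedler.

(** * The antipode is an anti-homomorphism *)

Section Antipode.
Variables (k : fieldType) (H : hopfAlg k).
Implicit Types (X : vectType k) (g h : H).
Local Notation S := (antipode H).
Local Notation "'Δ'" := (comul H).
Local Notation ε := (counit H).

Lemma comul_coassoc X (G : H -> H -> H -> X) h :
  (forall b c, linear (fun a => G a b c)) ->
  (forall a c, linear (fun b => G a b c)) ->
  (forall a b, linear (G a b)) ->
  tlift (fun h y => tlift (fun a b => G a b y) (Δ h)) (Δ h) =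
  tlift (fun a z => tlift (fun b y => G a b y) (Δ z)) (Δ h).
Proof. exact: (@coact_coassoc k H (reg_comod H)). Qed.

Lemma comul_counitl X (F : H -> X) h : linear F ->
  tlift (fun a b => (ε a : k) *: F b) (Δ h) = F h.
Proof. exact: (@coact_counit k H (reg_comod H)). Qed.

Lemma comul_counitr X (F : H -> X) h : linear F ->
  tlift (fun a b => (ε b : k) *: F a) (Δ h) = F h.
Proof.
move=> lF; rewrite -[in RHS](counitr h) (tlift_push _ _ lF).
by apply: eq_tlift_at => a b; rewrite -!(linfunE lF) linearZ.
Qed.

Lemma comul_antipodel X (F : H -> X) h : linear F ->
  tlift (fun a b => F (S a * b)) (Δ h) = (ε h : k) *: F 1.
Proof.
by move=> lF; rewrite -tlift_push // antipodel -!(linfunE lF) linearZ.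
Qed.

Lemma comul_antipoder X (F : H -> X) h : linear F ->
  tlift (fun a b => F (a * S b)) (Δ h) = (ε h : k) *: F 1.
Proof.
by move=> lF; rewrite -tlift_push // antipoder -!(linfunE lF) linearZ.
Qed.

Lemma comul_mul X (G : H -> H -> X) g h : bilin G ->
  tlift G (Δ (g * h)) =
  tlift (fun g1 g2 => tlift (fun h1 h2 => G (g1 * h1) (g2 * h2)) (Δ h)) (Δ g).
Proof.
move=> bG; rewrite comulM [LHS]linear_tlift; apply: eq_tlift_at => a b /=.
by rewrite tlift_tmap //; apply: eq_tlift_at => c d; rewrite !lfunE.
Qed.

(** Both sides are convolution inverses of the multiplication of H: the sum of
    S(g_1 h_1) (g_2 h_2) S(h_3) S(g_3) collapses to S(gh) when g_2 h_2 is
    cancelled against S(h_3) S(g_3), and to S(h) S(g) when it is cancelled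
    against S(g_1 h_1). *)
Lemma antipodeM g h : S (g * h) = S h * S g.
Proof.
have Q g' h' : tlift (fun g2 g3 => tlift (fun h2 h3 =>
    g2 * (h2 * S h3) * S g3) (Δ h')) (Δ g') = (ε h' : k) *: (ε g' : k)%:A.
  rewrite -antipoder scaler_tlift; apply: eq_tlift_at => a b.
  rewrite (@comul_antipoder _ (fun z => a * z * S b)); last by lin.
  by rewrite mulr1.
transitivity (tlift (fun g1 g' => tlift (fun h1 h' => S (g1 * h1) *
    tlift (fun g2 g3 => tlift (fun h2 h3 => g2 * (h2 * S h3) * S g3)
      (Δ h')) (Δ g')) (Δ h)) (Δ g)).
  transitivity (tlift (fun g1 g' => (ε g' : k) *: S (g1 * h)) (Δ g)).
    by rewrite (@comul_counitr _ (fun g1 => S (g1 * h))); try lin.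
  apply: eq_tlift_at => g1 g'.
  rewrite -(@comul_counitr _ (fun h1 => S (g1 * h1))); last by lin.
  rewrite scaler_tlift; apply: eq_tlift_at => h1 h'; rewrite Q.
  by rewrite -!scalerAr mulr1 !scalerA mulrC.
transitivity (tlift (fun g' g3 => tlift (fun g1 g2 => tlift (fun h' h3 =>
   tlift (fun h1 h2 => (S (g1 * h1) * (g2 * h2)) * (S h3 * S g3))
      (Δ h')) (Δ h)) (Δ g')) (Δ g)).
  rewrite comul_coassoc; try lin.
  apply: eq_tlift_at => g1 g'; rewrite -exchange_tlift.
  transitivity (tlift (fun h1 h' => tlift (fun h2 h3 => tlift (fun g2 g3 =>
    (S (g1 * h1) * (g2 * h2)) * (S h3 * S g3)) (Δ g')) (Δ h')) (Δ h)).
    apply: eq_tlift_at => h1 h'; rewrite mulr_tlift exchange_tlift.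
    apply: eq_tlift_at => g2 g3; rewrite mulr_tlift.
    by apply: eq_tlift_at => h2 h3; rewrite !mulrA.
  rewrite -comul_coassoc; try lin.
  by apply: eq_tlift_at => h' h3; exact: exchange_tlift.
transitivity (tlift (fun g' g3 => (ε g' : k) *: (S h * S g3)) (Δ g)); last first.
  by rewrite (@comul_counitl _ (fun z => S h * S z)); try lin.
apply: eq_tlift_at => g' g3.
rewrite -(@comul_counitl _ (fun z => S z * S g3)); try lin.
rewrite scaler_tlift.
transitivity (tlift (fun h' h3 => tlift (fun g1 g2 => tlift (fun h1 h2 =>
    (S (g1 * h1) * (g2 * h2)) * (S h3 * S g3)) (Δ h')) (Δ g')) (Δ h)).
  exact: exchange_tlift.
apply: eq_tlift_at => h' h3; rewrite scalerA -counitM.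
rewrite -[in RHS](mul1r (S h3 * _)) scalerAl -antipodel comul_mul; last by lin.
by rewrite mull_tlift; apply: eq_tlift_at => g1 g2; rewrite mull_tlift.
Qed.
End Antipode.

(** * Dual bases *)

Section DualBasis.
Variable k : fieldType.
Implicit Types U V W X : vectType k.

Definition dcoord U i : dual U := linfun (coord (vbasis {:U}) i : U -> k^o).

Lemma dcoordE U i (u : U) : dcoord i u = coord (vbasis {:U}) i u.
Proof. exact: lfunE. Qed.

Lemma dcoord_vec U (u : U) : u = \sum_i (dcoord i u : k) *: (vbasis {:U})`_i.
Proof.
rewrite [LHS](coord_vbasis (memvf u)).
by apply: eq_bigr => i _; rewrite dcoordE.
Qed.

Lemma lin_dcoord U X (F : U -> X) u : linear F ->
  \sum_i (dcoord i u : k) *: F (vbasis {:U})`_i = F u.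
Proof.
move=> lF; rewrite [in RHS](dcoord_vec u) -(linfunE lF) linear_sum.
by apply: eq_bigr => i _; rewrite linearZ /= linfunE.
Qed.

Lemma dcoord_dual U (f : dual U) :
  f = \sum_(i < \dim {:U}) (f (vbasis {:U})`_i : k) *: dcoord i.
Proof.
apply/lfunP => u; rewrite sum_lfunE -[LHS](@lin_dcoord _ _ f); last by lin.
by apply: eq_bigr => i _; rewrite scale_lfunE [LHS]mulrC.
Qed.

Lemma dual_sep U (u v : U) : (forall f : dual U, f u = f v) -> u = v.
Proof.
by move=> uv; rewrite (dcoord_vec u) (dcoord_vec v); apply: eq_bigr => i _; rewrite uv.
Qed.

(** The canonical element sum e_i ⊗ e_i^* of U ⊗ U^* satisfies
    sum e_i ⊗ (e_i^* o f) = sum f(e_i) ⊗ e_i^*. *)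
Lemma trace_cyclic U X (B : U -> dual U -> X) (f : 'End(U)) : bilin B ->
  \sum_(i < \dim {:U}) B (vbasis {:U})`_i (dcoord i \o f)%VF =
  \sum_(i < \dim {:U}) B (f (vbasis {:U})`_i) (dcoord i).
Proof.
case=> l r.
under eq_bigr => i _ do rewrite (dcoord_dual (_ \o _)%VF) -(linfunE (r _)) linear_sum.
rewrite exchange_big; apply: eq_bigr => j _ /=.
under eq_bigr => i _ do rewrite linearZ /= linfunE // comp_lfunE.
by rewrite (@lin_dcoord _ _ (fun u => B u (dcoord j))).
Qed.

End DualBasis.

(** * Integrals and bijectivity of the antipode *)

Section Integral.
Variables (k : fieldType) (H : hopfAlg k).
Implicit Types (X : vectType k) (g h : H).
Local Notation S := (antipode H).
Local Notation "'Δ'" := (comul H).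
Local Notation ε := (counit H).
Local Notation e := (vbasis {:H}).

Lemma antipode1 : S 1 = 1.
Proof.
have := antipodel (1 : H); rewrite comul1 tliftE ?mulr1; last by lin.
by rewrite counit1 scale1r.
Qed.

(** H acts on H^* by (h phi)(y) = phi(S(h) y).  The map
    b ⊗ phi |-> sum b_1 ⊗ S(b_2) phi is an H-linear isomorphism from H ⊗ H^*
    onto H ⊗ H^* with H acting on the left factor alone; this is its
    composite with evaluation of the second factor at x. *)
Let twist x b (phi : dual H) : H :=
  tlift (fun b1 b2 => (phi (S (S b2) * x) : k) *: b1) (Δ b).

Let twistE h x b phi : h * twist x b phi =
  tlift (fun h1 h2 => twist x (h1 * b) (phi \o amull (S h2))%VF) (Δ h).
Proof.
pose G b1 b2 h1 h2 h3 : H := (phi (S (S h2 * h3) * (S (S b2) * x)) : k) *: (h1 * b1).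
transitivity (tlift (fun h1 h2 => tlift (fun h11 h12 => tlift (fun b1 b2 =>
   G b1 b2 h11 h12 h2) (Δ b)) (Δ h1)) (Δ h)); last first.
  apply: eq_tlift_at => h1 h2; rewrite /twist comul_mul; last by lin.
  apply: eq_tlift_at => h11 h12; apply: eq_tlift_at => b1 b2.
  by rewrite /G comp_lfunE [amull _ _]lfunE /= !antipodeM !mulrA.
rewrite /G comul_coassoc; try lin.
rewrite -(@comul_counitr _ _ _ (fun h => h * twist x b phi)); last by lin.
apply: eq_tlift_at => h1 z; rewrite /twist mulr_tlift scaler_tlift exchange_tlift.
apply: eq_tlift_at => b1 b2.
rewrite (@comul_antipodel _ _ _ (fun y => (phi (S y * (S (S b2) * x)) : k) *: (h1 * b1)));
  last by lin.
by rewrite antipode1 mul1r -scalerAr.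
Qed.

(** The image under twist of the invariant element sum e_i ⊗ e_i^*, hence a
    left integral. *)
Let coev_int x : H := \sum_(i < \dim {:H}) twist x e`_i (dcoord i).

Let coev_intE h x : h * coev_int x = (ε h : k) *: coev_int x.
Proof.
rewrite /coev_int mulr_sumr.
under eq_bigr => i _ do rewrite twistE.
rewrite sum_tlift.
transitivity (tlift (fun h1 h2 =>
  \sum_(i < \dim {:H}) twist x (h1 * S h2 * e`_i) (dcoord i)) (Δ h)).
  apply: eq_tlift_at => h1 h2.
  rewrite (@trace_cyclic _ _ _ (fun b phi => twist x (h1 * b) phi));
    last by rewrite /twist; lin.
  by apply: eq_bigr => i _; rewrite [amull _ _]lfunE /= mulrA.
rewrite (@comul_antipoder _ _ _ (fun y =>
  \sum_(i < \dim {:H}) twist x (y * e`_i) (dcoord i))).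
  by congr (_ *: _); apply: eq_bigr => i _; rewrite mul1r.
by rewrite /twist; lin.
Qed.

(** If all these integrals vanished, so would the sum over i of
    e_i1 e_i^*(S(S(e_i3)) S(e_i2)), which is obtained from them by applying the
    inverse of the isomorphism above; but that sum is 1. *)
Let coev_int_neq0 : exists x, coev_int x != 0.
Proof.
case: (boolP [exists j : 'I_(\dim {:H}), coev_int (S e`_j) != 0]) => [/existsP[j]|].
  by exists (S e`_j).
rewrite negb_exists => /forallP /= L0; case/eqP: (oner_neq0 H).
rewrite [LHS]dcoord_vec.
transitivity (\sum_(i < \dim {:H}) tlift (fun a b => tlift (fun a1 a2 =>
   (dcoord i (S (a2 * S b)) : k) *: a1) (Δ a)) (Δ e`_i)).
  apply: eq_bigr => i _; rewrite comul_coassoc; try lin.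
  rewrite -(@comul_counitr _ _ _ (fun y => (dcoord i 1 : k) *: y)); last by lin.
  apply: eq_tlift_at => a1 z.
  rewrite (@comul_antipoder _ _ _ (fun y => (dcoord i (S y) : k) *: a1));
    last by lin.
  by rewrite antipode1.
pose chi j (y : H) := tlift (fun a1 a2 => (dcoord j a2 : k) *: a1) (Δ y).
transitivity (\sum_(j < \dim {:H}) chi j (coev_int (S e`_j))); last first.
  rewrite big1 // => j _; move: (L0 j); rewrite negbK => /eqP ->.
  by rewrite /chi !linear0.
have lchi j : linear (chi j) by rewrite /chi; lin.
transitivity (\sum_(j < \dim {:H}) \sum_(i < \dim {:H}) tlift (fun a b =>
    (dcoord i (S (S b) * S e`_j) : k) *: chi j a) (Δ e`_i)); last first.
  apply: eq_bigr => j _; rewrite /coev_int -[RHS](linfunE (lchi j)) linear_sum.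
  apply: eq_bigr => i _; rewrite linear_tlift; apply: eq_tlift_at => a b /=.
  by rewrite linearZ /= linfunE.
rewrite exchange_big; apply: eq_bigr => i _; rewrite sum_tlift.
apply: eq_tlift_at => a b; rewrite /chi.
under [RHS]eq_bigr => j _ do rewrite scaler_tlift.
rewrite sum_tlift; apply: eq_tlift_at => a1 a2.
rewrite -(@lin_dcoord _ _ _ (fun y => (dcoord i (S (y * S b)) : k) *: a1));
  last by lin.
apply: eq_bigr => j _; rewrite antipodeM; by rewrite !scalerA mulrC.
Qed.

Lemma exists_integral : exists2 L : H, L != 0 & forall h, h * L = (ε h : k) *: L.
Proof.
by have [x Lx] := coev_int_neq0; exists (coev_int x) => // h; exact: coev_intE.
Qed.

(** For a nonzero left integral L put D(chi) = sum chi(L_1) S(L_2).  Comparing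
    g_1 L_1 ⊗ S(g_2 L_2) g_3 with L_1 ⊗ S(L_2) g gives
    D(chi) g = D(chi o (g -)), so D(chi) g is in the image of S.  For chi with
    chi(L) nonzero, chi(L) h = sum chi(L_1) S(S(L_2) L_3) h, and expanding L_2
    in a basis makes this a sum of elements D(chi_j) g_j. *)
Lemma limg_antipode : limg S = fullv.
Proof.
have [L L0 LE] := exists_integral.
pose D (chi : dual H) := tlift (fun a b => (chi a : k) *: S b) (Δ L).
have DM chi g : D chi * g = D (chi \o amull g)%VF.
  transitivity (tlift (fun g' g3 => tlift (fun g1 g2 => tlift (fun a b =>
     (chi (g1 * a) : k) *: S (g2 * b) * g3) (Δ L)) (Δ g')) (Δ g)).
    rewrite -(@comul_counitl _ _ _ (fun y => D chi * y)); last by lin.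
    apply: eq_tlift_at => g' g3.
    rewrite -(@comul_mul _ _ _ (fun a b => (chi a : k) *: S b * g3)); last by lin.
    rewrite LE !linearZ /=; congr (_ *: _).
    by rewrite /D mull_tlift; apply: eq_tlift_at => a b.
  rewrite comul_coassoc; try lin.
  rewrite -(@comul_counitr _ _ _ (fun y => D (chi \o amull y)%VF)); last first.
    rewrite /D; apply: lin_tlift => a b; apply: lin_scalel.
    by move=> c x y; rewrite !comp_lfunE ![amull _ _]lfunE /= mulrDl -scalerAl linearP.
  apply: eq_tlift_at => g1 z; rewrite exchange_tlift /D scaler_tlift.
  apply: eq_tlift_at => a b; rewrite comp_lfunE [amull _ _]lfunE /=.
  transitivity (tlift (fun g2 g3 => (chi (g1 * a) : k) *: (S b * (S g2 * g3))) (Δ z)).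
    by apply: eq_tlift_at => g2 g3; rewrite antipodeM -scalerAl mulrA.
  rewrite (@comul_antipodel _ _ _ (fun y => (chi (g1 * a) : k) *: (S b * y)));
    last by lin.
  by rewrite mulr1.
have Dim chi g : D chi * g \in limg S.
  rewrite DM; apply: memv_tlift => a b; apply: memvZ; apply: memv_img; exact: memvf.
have [i Li] : exists i, dcoord i L != 0.
  case: (boolP [exists i, dcoord i L != 0 :> k]) => [/existsP //|].
  rewrite negb_exists => /forallP /= d0; case/eqP: L0.
  rewrite [LHS]dcoord_vec big1 // => i _; move: (d0 i); rewrite negbK => /eqP ->.
  exact: scale0r.
apply/vspaceP => h; rewrite memvf.
suff: (dcoord i L : k) *: h \in limg S.
  by move/(memvZ (dcoord i L : k)^-1); rewrite scalerA mulVf // scale1r.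
have lchi j : linear (fun y : H =>
    tlift (fun a1 a2 => (dcoord i a1 : k) *: dcoord j a2) (Δ y)) by lin.
pose chi j : dual H := linfun (fun y : H =>
   tlift (fun a1 a2 => (dcoord i a1 : k) *: dcoord j a2) (Δ y)).
suff -> : (dcoord i L : k) *: h = \sum_(j < \dim {:H}) D (chi j) * (S (S e`_j) * h).
  by apply: memv_suml => j _.
transitivity (tlift (fun a b => tlift (fun a1 a2 =>
    (dcoord i a1 : k) *: (S (S a2 * b) * h)) (Δ a)) (Δ L)).
  rewrite comul_coassoc; try lin.
  rewrite -(@comul_counitr _ _ _ (fun y => (dcoord i y : k) *: h)); last by lin.
  apply: eq_tlift_at => a1 z.
  rewrite (@comul_antipodel _ _ _ (fun y => (dcoord i a1 : k) *: (S y * h)));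
    last by lin.
  by rewrite antipode1 mul1r.
rewrite /D; under [RHS]eq_bigr => j _ do rewrite mull_tlift.
rewrite sum_tlift; apply: eq_tlift_at => a b.
under [RHS]eq_bigr => j _ do rewrite -scalerAl /chi linfunE // -tlift_scalel.
rewrite sum_tlift; apply: eq_tlift_at => a1 a2.
rewrite -(@lin_dcoord _ _ _ (fun y => (dcoord i a1 : k) *: (S (S y * b) * h)));
  last by lin.
apply: eq_bigr => j _; rewrite antipodeM !mulrA scalerA; congr (_ *: _).
exact: mulrC.
Qed.

Local Notation S' := (S^-1%VF).

Lemma antipodeVK : cancel S' S.
Proof. by move=> h; rewrite limg_lfunVK // limg_antipode memvf. Qed.

(** A surjective endomorphism of a finite-dimensional space is injective. *)
Lemma antipodeKV : cancel S S'.
Proof.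
have lk : lker S == 0%VS.
  by have := limg_ker_dim S fullv; rewrite limg_antipode capfv => /eqP;
    rewrite -[X in _ == X]add0n eqn_add2r dimv_eq0.
exact: lker0_lfunK.
Qed.

Lemma antipodeVM g h : S' (g * h) = S' h * S' g.
Proof. by apply: (can_inj antipodeKV); rewrite antipodeM !antipodeVK. Qed.

Lemma antipodeV1 : S' 1 = 1.
Proof. by apply: (can_inj antipodeKV); rewrite antipode1 !antipodeVK. Qed.

(** The two identities for S^-1, in which the order of the coproduct is
    reversed; they are the images of the antipode axioms under S^-1. *)
Lemma comul_antipodeVl X (F : H -> X) h : linear F ->
  tlift (fun a b => F (S' b * a)) (Δ h) = (ε h : k) *: F 1.
Proof.
move=> lF; rewrite -[1 in RHS]antipodeV1 -(@comul_antipodel _ _ _ (fun y => F (S' y))).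
  by apply: eq_tlift_at => a b; rewrite antipodeVM antipodeKV.
by move=> c x y; rewrite linearP lF.
Qed.

Lemma comul_antipodeVr X (F : H -> X) h : linear F ->
  tlift (fun a b => F (b * S' a)) (Δ h) = (ε h : k) *: F 1.
Proof.
move=> lF; rewrite -[1 in RHS]antipodeV1 -(@comul_antipoder _ _ _ (fun y => F (S' y))).
  by apply: eq_tlift_at => a b; rewrite antipodeVM antipodeKV.
by move=> c x y; rewrite linearP lF.
Qed.
End Integral.

(** * Tensors over a dual space as families of vectors *)

Section DualTensor.
Variables (k : fieldType) (U : vectType k).
Implicit Types (V W E : vectType k) (t : U).

(** U^* ⊗ V is the space of linear maps U -> V: tens_ev evaluates a tensor at a
    point of U, and tens_of is the inverse passage from maps to tensors. *)
Definition tens_ev V t : 'Hom(tens (dual U) V, V) :=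
  tlift (fun (g : dual U) v => (g t : k) *: v).

Lemma tens_evE V t g (v : V) : tens_ev V t (g ⊗ v) = (g t : k) *: v.
Proof. by rewrite tliftE //; lin. Qed.

Definition tens_of V (F : U -> V) : tens (dual U) V :=
  \sum_(i < \dim {:U}) dcoord i ⊗ F (vbasis {:U})`_i.

Lemma tens_ofK V (F : U -> V) t : linear F -> tens_ev V t (tens_of F) = F t.
Proof.
move=> lF; rewrite linear_sum -[RHS](lin_dcoord t lF).
by apply: eq_bigr => i _; rewrite /= tens_evE.
Qed.

Lemma lin_tens_ev V y : linear (fun t => tens_ev V t y).
Proof.
have lE : linear (tens_ev V).
  move=> c a b; apply: tens_hom_eq => g v.
  rewrite add_lfunE scale_lfunE !tens_evE.
  by rewrite linearP scalerDl scalerA.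
exact: lin_app.
Qed.

Lemma lin_tens_evl V E (F : E -> U) y :
  linear F -> linear (fun s => tens_ev V (F s) y).
Proof. by move=> lF c a b; rewrite lF lin_tens_ev. Qed.

Lemma tens_evK V y : tens_of (fun t => tens_ev V t y) = y.
Proof.
have l : linear (fun y => tens_of (fun t => tens_ev V t y)) by rewrite /tens_of; lin.
rewrite -[LHS](linfunE l) -[RHS]id_lfunE; congr (fun_of_lfun _ y).
apply: tens_hom_eq => g v; rewrite linfunE // id_lfunE.
rewrite [in RHS](dcoord_dual g).
have lp : linear (fun g : dual U => g ⊗ v) by lin.
rewrite -[RHS](linfunE lp) linear_sum; apply: eq_bigr => i _.
by rewrite tens_evE linearZ /= linfunE // pureZr.
Qed.

Lemma tens_ev_inj V (y z : tens (dual U) V) :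
  (forall t, tens_ev V t y = tens_ev V t z) -> y = z.
Proof.
move=> yz; rewrite -[y]tens_evK -[z]tens_evK; apply: eq_bigr => i _.
by rewrite yz.
Qed.

End DualTensor.

(** * The stabilizer as an internal Hom *)

Section Stab.
Variables (k : fieldType) (H : hopfAlg k) (K : comodAlg H).
Implicit Types (V W : rep K) (X : rep H) (t h : H) (x : K).
Local Notation S := (antipode H).
Local Notation "'Δ'" := (comul H).
Local Notation ε := (counit H).
Local Notation S' := (S^-1%VF).

Lemma tens_ev_Lmap V W y (xi : dual H) (v : V) t :
  tens_ev W t (Lmap V W y (xi ⊗ v)) =
  tlift (fun a b => (xi b : k) *: tens_ev _ a y v) (Δ t).
Proof.
have l1 : linear (fun y => tens_ev W t (Lmap V W y (xi ⊗ v))) by lin.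
have l2 : linear (fun y =>
  tlift (fun a b => (xi b : k) *: tens_ev 'Hom(V, W) a y v) (Δ t)).
  by lin.
rewrite -[LHS](linfunE l1) -[RHS](linfunE l2); congr (fun_of_lfun _ y).
apply: tens_hom_eq => g f; rewrite (linfunE l1) (linfunE l2) LmapE tmapE tens_evE.
rewrite convlE convmulE -tlift_scalel; apply: eq_tlift_at => a b.
by rewrite tens_evE scale_lfunE scalerA mulrC.
Qed.

(** Evaluating at the unit of the algebra H^* recovers the family from the
    operator, hence Lmap is injective. *)
Lemma tens_ev_counit V W y (v : V) t :
  tens_ev W t (Lmap V W y ((ε : dual H) ⊗ v)) = tens_ev _ t y v.
Proof.
rewrite tens_ev_Lmap (@comul_counitr _ _ _ (fun a => tens_ev _ a y v)) //.
by apply: lin_app; exact: lin_tens_ev.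
Qed.

Lemma Lmap_inj V W : injective (Lmap V W).
Proof.
move=> y z yz; apply: tens_ev_inj => t; apply/lfunP => v.
by rewrite -!tens_ev_counit yz.
Qed.

Lemma tens_ev_stab_op V x t tau :
  tens_ev V t (stab_op V x tau) =
  tlift (fun h y => rho V y (tens_ev V (S' h * t) tau)) (coact K x).
Proof.
have l1 : linear (fun tau => tens_ev V t (stab_op V x tau)) by lin.
have l2 : linear (fun tau =>
  tlift (fun h y => rho V y (tens_ev V (S' h * t) tau)) (coact K x)) by lin.
rewrite -[LHS](linfunE l1) -[RHS](linfunE l2); congr (fun_of_lfun _ tau).
apply: tens_hom_eq => g v; rewrite (linfunE l1) (linfunE l2).
rewrite /stab_op comp_lfunE tlift_app linear_tlift.
apply: eq_tlift_at => h y; rewrite /= tmapE !tens_evE harpE linearZ.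
by [].
Qed.

(** K-linearity of z says z(x m)(t) = sum x_(0) z(m)(S^-1(x_(-1)) t).  Applying
    this to x_(0) and x_(-1) t makes S^-1 cancel on the right, which spares the
    computation of the coproduct of S^-1(x_(-1)) t when z comes from Lmap. *)
Lemma stab_homopP V W (z : 'Hom(tens (dual H) V, tens (dual H) W)) :
  (z \in homop (stab_op V) (stab_op W)) <->
  (forall x t (xi : dual H) (v : V),
     tlift (fun h y => tens_ev W (h * t) (z (stab_op V y (xi ⊗ v)))) (coact K x) =
     rho W x (tens_ev W t (z (xi ⊗ v)))).
Proof.
have lt w : linear (fun t => tens_ev W t w) by exact: lin_tens_ev.
have lh (F : H -> H) w : linear F -> linear (fun t => tens_ev W (F t) w).
  by move=> lF c a b; rewrite lF lt.
split=> [/homopP zop x t xi v | zop].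
  transitivity (tlift (fun h y => tlift (fun h' y' =>
      rho W y' (tens_ev W (S' h' * h * t) (z (xi ⊗ v)))) (coact K y)) (coact K x)).
    apply: eq_tlift_at => h y; rewrite zop tens_ev_stab_op.
    by apply: eq_tlift_at => h' y'; rewrite mulrA.
  rewrite -coact_coassoc.
  - rewrite -(@coact_counit _ _ _ _ (fun y => rho W y (tens_ev W t (z (xi ⊗ v)))));
      last by lin.
    apply: eq_tlift_at => h y.
    rewrite (@comul_antipodeVl _ _ _ (fun s => rho W y (tens_ev W (s * t) (z (xi ⊗ v))))) ?mul1r //.
    by apply: lin_comp; apply: lh; lin.
  - by move=> b y; apply: lin_comp; apply: lh; lin.
  - by move=> b y; apply: lin_comp; apply: (lh (fun s => S' s * b * t)); lin.
  - by lin.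
apply/homopP => x tau; rewrite -!comp_lfunE; congr (fun_of_lfun _ tau).
apply: tens_hom_eq => xi v; rewrite [LHS]comp_lfunE [RHS]comp_lfunE.
apply: tens_ev_inj => t; rewrite tens_ev_stab_op.
transitivity (tlift (fun h y => tlift (fun h' y' =>
   tens_ev W (h' * (S' h * t)) (z (stab_op V y' (xi ⊗ v)))) (coact K y)) (coact K x));
     last first.
  by apply: eq_tlift_at => h y; rewrite zop.
rewrite -coact_coassoc.
- rewrite -(@coact_counit _ _ _ _ (fun y => tens_ev W t (z (stab_op V y (xi ⊗ v)))));
    last by lin.
  apply: eq_tlift_at => h y.
  transitivity (tlift (fun a b => tens_ev W (b * S' a * t) (z (stab_op V y (xi ⊗ v)))) (Δ h));
    last first.
    by apply: eq_tlift_at => a b; rewrite mulrA.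
  rewrite (@comul_antipodeVr _ _ _ (fun s => tens_ev W (s * t) (z (stab_op V y (xi ⊗ v))))) ?mul1r //.
  by apply: lh; lin.
- by move=> b y; apply: (lh (fun s => b * (S' s * t))); lin.
- by move=> a y; apply: lh; lin.
- by lin.
Qed.

Lemma stab_op_pure V x (xi : dual H) (v : V) :
  stab_op V x (xi ⊗ v) = tlift (fun h y => harp H h xi ⊗ rho V y v) (coact K x).
Proof.
by rewrite /stab_op comp_lfunE tlift_app; apply: eq_tlift_at => h y; rewrite tmapE.
Qed.

(** In the left-hand side the action of K on H^* contributes
    xi(S^-1(x_(-1)) x_(-2) t_2), in which the first two factors cancel; what is
    left is the coaction on the family alone. *)
Lemma coact_Lmap V W y x t (xi : dual H) (v : V) :
  tlift (fun h x' => tens_ev W (h * t) (Lmap V W y (stab_op V x' (xi ⊗ v)))) (coact K x) =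
  tlift (fun a b => (xi b : k) *:
    tlift (fun h x' => tens_ev _ (h * a) y (rho V x' v)) (coact K x)) (Δ t).
Proof.
(* h1, h2, h3 stand for x_(-3), x_(-2), x_(-1) and x' for x_(0). *)
pose R h1 h2 h3 x' := tlift (fun a b =>
  (xi (S' h3 * h2 * b) : k) *: tens_ev _ (h1 * a) y (rho V x' v)) (Δ t).
have lE (F : H -> H) w : linear F -> linear (fun t => tens_ev 'Hom(V, W) (F t) y w).
  by move=> lF; apply: lin_app; exact: lin_tens_evl.
have R1 h2 h3 x' : linear (fun h1 => R h1 h2 h3 x').
  by apply: lin_tlift => a b; apply: lin_scaler; apply: lE; lin.
have R2 h1 h3 x' : linear (fun h2 => R h1 h2 h3 x') by rewrite /R; lin.
have R3 h1 h2 x' : linear (fun h3 => R h1 h2 h3 x') by rewrite /R; lin.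
have R4 h1 h2 h3 : linear (R h1 h2 h3) by rewrite /R; lin.
transitivity (tlift (fun h x' => tlift (fun h3 x'' => tlift (fun h1 h2 =>
    R h1 h2 h3 x'') (Δ h)) (coact K x')) (coact K x)).
  apply: eq_tlift_at => h x'.
  rewrite stab_op_pure linear_tlift [LHS]linear_tlift.
  apply: eq_tlift_at => h3 x''; rewrite /= tens_ev_Lmap comul_mul; last first.
    by split=> [b|a]; [apply: lin_scaler; apply: lE; lin | lin].
  apply: eq_tlift_at => h1 h2; apply: eq_tlift_at => a b.
  by rewrite harpE mulrA.
rewrite -coact_coassoc; last 3 first.
- by lin.
- by move=> a z; apply: lin_tlift => h1 h2; exact: R3.
- by move=> a b; apply: lin_tlift => h1 h2; exact: R4.
  transitivity (tlift (fun h x' => R h 1 1 x') (coact K x)).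
    apply: eq_tlift_at => h x'; rewrite comul_coassoc //.
    rewrite -(@comul_counitr _ _ _ (fun h => R h 1 1 x')) //.
    apply: eq_tlift_at => h1 z.
    transitivity (tlift (fun a b => R h1 (S' b * a) 1 x') (Δ z)).
      apply: eq_tlift_at => a b; rewrite /R; apply: eq_tlift_at => c d.
      by rewrite antipodeV1 mul1r.
    by rewrite (@comul_antipodeVl _ _ _ (fun s => R h1 s 1 x')).
  rewrite exchange_tlift; apply: eq_tlift_at => a b; rewrite scaler_tlift.
  by apply: eq_tlift_at => h x'; rewrite antipodeV1 !mul1r.
Qed.

(** The stabilizer consists of the families F that are K-linear on H ⊗ V;
    the direct implication is the case xi = counit of coact_Lmap. *)
Lemma stabP V W y :
  (Lmap V W y \in stab V W) <->
  (forall x t (v : V), tlift (fun h x' => tens_ev _ (h * t) y (rho V x' v)) (coact K x) =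
     rho W x (tens_ev _ t y v)).
Proof.
have E t v : tlift (fun a b => (ε b : k) *: tens_ev 'Hom(V, W) a y v) (Δ t) = tens_ev _ t y v.
  by rewrite -tens_ev_Lmap tens_ev_counit.
rewrite memv_cap memv_img ?memvf // andbT; split=> [/stab_homopP st x t v | st].
  rewrite -tens_ev_counit -st coact_Lmap.
  rewrite (@comul_counitr _ _ _ (fun a => tlift (fun h x' =>
    tens_ev 'Hom(V, W) (h * a) y (rho V x' v)) (coact K x))) //.
  apply: lin_tlift => h x'; apply: lin_app; apply: lin_tens_evl; lin.
apply/stab_homopP => x t xi v; rewrite coact_Lmap tens_ev_Lmap linear_tlift.
by apply: eq_tlift_at => a b; rewrite st linearZ.
Qed.

Lemma tens_ev_hit (V : vectType k) t h y :
  tens_ev V t (tmap (hit H h) \1%VF y) = tens_ev V (t * h) y.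
Proof.
rewrite -comp_lfunE; congr (fun_of_lfun _ y); apply: tens_hom_eq => g v.
by rewrite comp_lfunE tmapE !tens_evE hitE id_lfunE.
Qed.

End Stab.

(** * Linearity over a Hopf algebra, with the antipode *)

Section Twisted.
Variables (k : fieldType) (H : hopfAlg k) (X V W : rep H).
Variable G : 'Hom(tens X V, W).
Local Notation "'Δ'" := (comul H).
Local Notation S' := ((antipode H)^-1%VF).
Implicit Types (c : H) (x : X) (v : V).

(** The form in which H-linearity of G appears when G is read off a functional
    on an induced module: the relations of that module involve S^-1 through the
    actions on W^* and on the dual. *)
Definition moved_left := forall c x v,
  tlift (fun a b => rho W (S' b) (G (x ⊗ rho V a v))) (Δ c) = G (rho X (S' c) x ⊗ v).

(** Halfway between moved_left, where S^-1 acts on both X and W, and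
    H-linearity, where it acts on neither. *)
Let moved_half := forall c x v,
  tlift (fun a b => rho W b (G (rho X (S' a) x ⊗ v))) (Δ c) = G (x ⊗ rho V c v).

Let rhoME (M : rep H) a b (m : M) : rho M a (rho M b m) = rho M (a * b) m.
Proof. by rewrite rhoM comp_lfunE. Qed.

Let rho1E (M : rep H) (m : M) : rho M 1 m = m.
Proof. by rewrite rho1 id_lfunE. Qed.

Let moved_leftP : moved_left <-> moved_half.
Proof.
split=> hG c x v.
  transitivity (tlift (fun c1 c2 => tlift (fun a b =>
      rho W (c2 * S' b) (G (x ⊗ rho V a v))) (Δ c1)) (Δ c)).
    apply: eq_tlift_at => c1 c2; rewrite -hG linear_tlift.
    by apply: eq_tlift_at => a b; rewrite /= rhoME.
  rewrite comul_coassoc; try lin.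
  rewrite -(@comul_counitr _ _ _ (fun a => G (x ⊗ rho V a v))); last by lin.
  apply: eq_tlift_at => a z.
  rewrite (@comul_antipodeVr _ _ _ (fun s => rho W s (G (x ⊗ rho V a v))));
    last by lin.
  by rewrite rho1E.
transitivity (tlift (fun c1 c2 => tlift (fun a b =>
    rho W (S' c2 * b) (G (rho X (S' a) x ⊗ v))) (Δ c1)) (Δ c)).
  apply: eq_tlift_at => c1 c2; rewrite -hG linear_tlift.
  by apply: eq_tlift_at => a b; rewrite /= rhoME.
rewrite comul_coassoc; try lin.
rewrite -(@comul_counitr _ _ _ (fun a => G (rho X (S' a) x ⊗ v))); last by lin.
apply: eq_tlift_at => a z.
rewrite (@comul_antipodeVl _ _ _ (fun s => rho W s (G (rho X (S' a) x ⊗ v))));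
  last by lin.
by rewrite rho1E.
Qed.

Lemma tens_repHE c x v : rho (tens_rep (K := reg_comod H) X V) c (x ⊗ v) =
  tlift (fun a b => rho X a x ⊗ rho V b v) (Δ c).
Proof. exact: tens_repE. Qed.

Lemma moved_left_homrep :
  G \in homrep (tens_rep (K := reg_comod H) X V) W <-> moved_left.
Proof.
suff: G \in homrep (tens_rep (K := reg_comod H) X V) W <-> moved_half.
  by have [??] := moved_leftP; case=> ??; split; auto.
split=> [/homopP hG c x v | hG].
  transitivity (tlift (fun c1 z => tlift (fun a b =>
      G (rho X (a * S' c1) x ⊗ rho V b v)) (Δ z)) (Δ c)).
    apply: eq_tlift_at => c1 z; rewrite -hG tens_repHE linear_tlift.
    by apply: eq_tlift_at => a b; rewrite /= rhoME.
  rewrite -comul_coassoc; try lin.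
  rewrite -(@comul_counitl _ _ _ (fun b => G (x ⊗ rho V b v))); last by lin.
  apply: eq_tlift_at => z b.
  rewrite (@comul_antipodeVr _ _ _ (fun s => G (rho X s x ⊗ rho V b v)));
    last by lin.
  by rewrite rho1E.
apply/homopP => c t; rewrite -!comp_lfunE; congr (fun_of_lfun _ t).
apply: tens_hom_eq => x v; rewrite [LHS]comp_lfunE [RHS]comp_lfunE.
rewrite tens_repHE linear_tlift /=.
transitivity (tlift (fun a z => tlift (fun b c' =>
    rho W c' (G (rho X (S' b * a) x ⊗ v))) (Δ z)) (Δ c)).
  apply: eq_tlift_at => a z; rewrite -hG.
  by apply: eq_tlift_at => b c'; rewrite rhoME.
rewrite -comul_coassoc; try lin.
rewrite -[RHS](@comul_counitl _ _ _ (fun b => rho W b (G (x ⊗ v)))); last by lin.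
apply: eq_tlift_at => z b.
rewrite (@comul_antipodeVl _ _ _ (fun s => rho W b (G (rho X s x ⊗ v))));
  last by lin.
by rewrite rho1E.
Qed.

End Twisted.

(** * From functionals on V ⊗ W^* to maps into W *)

Section Undual.
Variables (k : fieldType) (X V W : vectType k).

(** The identification of Hom(X, (V ⊗ W^* )^* ) with Hom(X ⊗ V, W) that comes
    from W = W^**; undualE characterizes it. *)
Definition undual (beta : 'Hom(X, dual (tens V (dual W)))) : 'Hom(tens X V, W) :=
  tlift (fun x v => \sum_(j < \dim {:W}) (beta x (v ⊗ dcoord j) : k) *: (vbasis {:W})`_j).

Lemma undualE beta x v (f : dual W) : f (undual beta (x ⊗ v)) = beta x (v ⊗ f).
Proof.
rewrite tliftE; last by lin.
rewrite linear_sum [in RHS](dcoord_dual f).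
have l : linear (fun f : dual W => beta x (v ⊗ f)) by lin.
rewrite -[RHS](linfunE l) linear_sum; apply: eq_bigr => j _.
by rewrite !linearZ /= linfunE // [LHS]mulrC.
Qed.

End Undual.

(** * Functionals on an induced module *)

Section InducedDual.
Variables (k : fieldType) (H : hopfAlg k) (A : hopfSub H).
Local Notation B := (sub_hopf A).
Local Notation i := (hsub_inc A).

Lemma hsub_inc_antipodeV a : i ((antipode B)^-1%VF a) = (antipode H)^-1%VF (i a).
Proof.
apply: (can_inj (@antipodeKV _ H)); rewrite antipodeVK -sub_antipodeE.
by congr (i _); exact: (@antipodeVK _ B).
Qed.

Lemma ind_dual_eq (U : vectType k) (r : 'Hom(B, 'End(U))) (a b : dual (ind r)) :
  (forall h u, a (ind_cl r h u) = b (ind_cl r h u)) -> a = b.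
Proof.
move=> ab; apply/lfunP => q; rewrite -(quot_piK q).
rewrite -!(comp_lfunE _ (quot_pi _)); congr (fun_of_lfun _ _).
by apply: tens_hom_eq => h u; rewrite [LHS]comp_lfunE [RHS]comp_lfunE; exact: ab.
Qed.

(** H ⊗_A U is carried by a complement of the relations, so a functional on
    H ⊗ U is restricted to that complement; it descends when it is balanced
    over A. *)
Definition ind_lift (U : vectType k) (r : 'Hom(B, 'End(U))) (F : H -> U -> k^o) :
    dual (ind r) :=
  (tlift F \o linfun (@vsval k _ (ind_rel r)^C))%VF.

Lemma ind_liftE (U : vectType k) (r : 'Hom(B, 'End(U))) (F : H -> U -> k^o) :
  bilin F -> (forall h a u, F (h * i a) u = F h (r a u)) ->
  forall h u, ind_lift r F (ind_cl r h u) = F h u.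
Proof.
move=> bF FA h u.
have vanish t : t \in ind_rel r -> tlift F t = 0.
  case/memv_imgP => s _ ->; rewrite -comp_lfunE; set T := (_ \o _)%VF.
  suff -> : T = 0 by rewrite zero_lfunE.
  apply: tens_hom_eq => z w; rewrite comp_lfunE (tliftE (ind_rel_bilin r)).
  rewrite [RHS]zero_lfunE -comp_lfunE; set T' := (_ \o _)%VF.
  suff -> : T' = 0 by rewrite zero_lfunE.
  apply: tens_hom_eq => a v; rewrite comp_lfunE (tliftE (ind_rel_bilin2 r z)).
  by rewrite [RHS]zero_lfunE linearB /= !tliftE // FA subrr.
rewrite comp_lfunE [linfun (@vsval k _ _) _]lfunE /= -(tliftE bF).
apply/eqP; rewrite -subr_eq0 -linearB /=; apply/eqP/vanish.
by rewrite -[in X in _ \in X](lker_quot_pi (ind_rel r)) memv_ker linearB /= quot_piK subrr.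
Qed.

Lemma tensdual_opE (V W : rep B) c (v : V) (f : dual W) :
  tensdual_op V W c (v ⊗ f) =
  tlift (fun a b => rho V a v ⊗ (f \o rho W ((antipode B)^-1%VF b))%VF) (comul B c).
Proof.
rewrite /tensdual_op /tens_op comp_lfunE tlift_app; apply: eq_tlift_at => a b.
rewrite tmapE; congr pure; apply/lfunP => w.
by rewrite dual_opE comp_lfunE.
Qed.

End InducedDual.

(** * From K-linear maps to the stabilizer *)

Section Orbit.
Variables (k : fieldType) (H : hopfAlg k) (K : comodAlg H).
Implicit Types (X : rep H) (M N : rep K).

(** The family t |-> u(t x ⊗ -), as a tensor. *)
Definition orbit_tens X M N (u : 'Hom(tens X M, N)) (x : X) : tens (dual H) 'Hom(M, N) :=
  tens_of (fun h : H => linfun (fun m : M => u (rho X h x ⊗ m))).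

Lemma orbit_tensE X M N (u : 'Hom(tens X M, N)) x h m :
  tens_ev _ h (orbit_tens u x) m = u (rho X h x ⊗ m).
Proof. by rewrite tens_ofK ?linfunE //; lin. Qed.

Lemma orbit_tens_bilin X M N : bilin (@orbit_tens X M N).
Proof.
by split=> [x|u] a y z; apply: tens_ev_inj => h; apply/lfunP => m;
  rewrite linearP !(add_lfunE, scale_lfunE, orbit_tensE) /= ?linearP /= ?purePl ?linearP.
Qed.

Lemma orbit_tens_stab X M N (u : mor (tens_rep X M) N) x :
  Lmap M N (orbit_tens (vsval u) x) \in stab M N.
Proof.
apply/stabP => y t m; rewrite orbit_tensE -(mor_eq u) tens_repE linear_tlift.
by apply: eq_tlift_at => h y'; rewrite orbit_tensE rhoM comp_lfunE.
Qed.

Lemma orbit_tens_hit X M N (u : 'Hom(tens X M, N)) h x :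
  tmap (hit H h) \1%VF (orbit_tens u x) = orbit_tens u (rho X h x).
Proof.
apply: tens_ev_inj => t; rewrite tens_ev_hit; apply/lfunP => m.
by rewrite !orbit_tensE rhoM comp_lfunE.
Qed.

(** The H-linear map X -> Stab_K(M, N) that corresponds to u; vsproj makes it
    linear in u and x by construction, and val_orbit_stab shows that nothing
    is projected away. *)
Definition orbit_stab X M N :
    'Hom(mor (tens_rep X M) N, 'Hom(X, subvs_of (stab M N))) :=
  linfun (fun u => linfun (fun x => vsproj (stab M N) (Lmap M N (orbit_tens (vsval u) x)))).

Lemma val_orbit_stab X M N (u : mor (tens_rep X M) N) x :
  vsval (orbit_stab X M N u x) = Lmap M N (orbit_tens (vsval u) x).
Proof.
have [l r] := orbit_tens_bilin X M N.
have lx (u' : mor (tens_rep X M) N) :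
    linear (fun x => vsproj (stab M N) (Lmap M N (orbit_tens (vsval u') x))).
  by move=> a p q; rewrite r !linearP.
have lu y : linear (fun u' : mor (tens_rep X M) N =>
    vsproj (stab M N) (Lmap M N (orbit_tens (vsval u') y))).
  by move=> a p q; rewrite linearP l !linearP.
rewrite /orbit_stab (linfunE (lin_linfun lx lu)) (linfunE (lx u)).
by rewrite vsprojK ?orbit_tens_stab.
Qed.

Lemma orbit_stab_act X M N (u : mor (tens_rep X M) N) h x :
  orbit_stab X M N u (rho X h x) = stab_act h (orbit_stab X M N u x).
Proof.
apply: subvs_inj; rewrite (stab_actE _ (val_orbit_stab u x)) orbit_tens_hit.
exact: val_orbit_stab.
Qed.

Lemma orbit_stab_nat X X' M M' N N' (p : mor X' X) (f : mor M' M) (g : mor N N')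
    (u : mor (tens_rep X M) N) x :
  orbit_stab X' M' N' (morc g (morc u (tens_mor p f))) x =
  stab_map f g (orbit_stab X M N u (vsval p x)).
Proof.
apply: subvs_inj; rewrite [RHS]/= !val_orbit_stab /=; apply: tens_hom_eq => xi m.
rewrite !comp_lfunE !tmapE id_lfunE; apply: tens_ev_inj => t.
have evg z : tens_ev N' t (tmap \1%VF (vsval g) z) = vsval g (tens_ev N t z).
  rewrite -!comp_lfunE; congr (fun_of_lfun _ z); apply: tens_hom_eq => h n.
  by rewrite !comp_lfunE tmapE !tens_evE linearZ id_lfunE.
rewrite evg !tens_ev_Lmap linear_tlift; apply: eq_tlift_at => a b.
by rewrite !orbit_tensE /= linearZ !comp_lfunE tmapE mor_eq.
Qed.

Lemma orbit_stab_unit M c :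
  orbit_stab (triv_rep H) M M (lunit_mor M) c = (c : k) *: stab1 M.
Proof.
apply: subvs_inj; rewrite [RHS]/= val_orbit_stab /=; apply: tens_hom_eq => xi m.
rewrite scale_lfunE id_lfunE; apply: tens_ev_inj => t.
rewrite tens_ev_Lmap linearZ /= tens_evE.
rewrite -(@comul_counitl _ _ _ (fun b => (c : k) *: ((xi b : k) *: m)));
  last by lin.
apply: eq_tlift_at => a b; rewrite orbit_tensE lunitE /=.
rewrite (linfunE (@triv_linear k H)) scale_lfunE id_lfunE !scalerA.
congr (_ *: _).
by rewrite mulrC -mulrA; congr (_ * _); rewrite mulrC.
Qed.

End Orbit.

(** * The adjunction *)

Section Adjunction.
Variables (k : fieldType) (H : hopfAlg k) (A : hopfSub H) (K : comodAlg H).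
Variable T : repfunctor (sub_hopf A) K.
Local Notation B := (sub_hopf A).
Variable w : forall V W : rep B,
  'Hom(subvs_of (stab (T V) (T W)), dual (ind (tensdual_op V W))).
Hypothesis w_bij : forall V W, bijective (w V W).
Hypothesis w_act : forall V W h x,
  w V W (stab_act h x) = dual_ind_op (tensdual_op V W) h (w V W x).
Local Notation "'Δ'" := (comul H).
Local Notation S := (antipode H).
Local Notation S' := (S^-1%VF).
Local Notation "X ⊗A V" := (tens_rep (K := reg_comod B) (res A X) V) (at level 40).

Section Equivariant.
Variables (X : rep H) (V W : rep B).
Variable phi : X -> dual (ind (tensdual_op V W)).
Hypothesis phi_act : forall h x,
  phi (rho X h x) = dual_ind_op (tensdual_op V W) h (phi x).

Lemma equivariant_cl h x t :
  phi x (ind_cl (tensdual_op V W) h t) = phi (rho X (S' h) x) (ind_cl (tensdual_op V W) 1 t).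
Proof. by rewrite phi_act dual_opE antipodeVK ind_opE mulr1. Qed.

(** On the class of a ⊗ (v ⊗ f) with a in A, phi(x) can be computed by moving a
    to x, by equivariance, or to v ⊗ f, by the relations over A; the two
    results are the two sides of moved_left. *)
Lemma equivariant_moved_left (G : 'Hom(tens X V, W)) :
  (forall x v (f : dual W), f (G (x ⊗ v)) = phi x (ind_cl (tensdual_op V W) 1 (v ⊗ f))) ->
  moved_left (X := res A X) G.
Proof.
move=> GE c x v; apply: dual_sep => f; rewrite linear_tlift GE.
rewrite [rho (res A X) _]comp_lfunE hsub_inc_antipodeV -equivariant_cl -[hsub_inc A c]mul1r.
rewrite ind_clM tensdual_opE.
have l : linear (ind_cl (tensdual_op V W) (1 : H)) by rewrite /ind_cl; lin.
rewrite (tlift_push _ _ l) linear_tlift; apply: eq_tlift_at => a b.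
by rewrite /= -GE comp_lfunE.
Qed.

End Equivariant.

Section Xi.
Variables (X : rep H) (V W : rep B).
Local Notation r := (tensdual_op V W).
Implicit Type u : mor (tens_rep X (T V)) (T W).

Lemma lin_ind_cl1 : linear (ind_cl r (1 : H)).
Proof. by rewrite /ind_cl; lin. Qed.

Definition xi_hom u : 'Hom(tens X V, W) :=
  undual (dual_map (linfun (ind_cl r (1 : H))) \o (w V W \o orbit_stab X (T V) (T W) u))%VF.

Lemma xi_homE u x v (f : dual W) :
  f (xi_hom u (x ⊗ v)) = w V W (orbit_stab X (T V) (T W) u x) (ind_cl r 1 (v ⊗ f)).
Proof.
rewrite undualE comp_lfunE dual_mapE 2!comp_lfunE.
by rewrite (linfunE lin_ind_cl1).
Qed.

Lemma xi_hom_linear : linear xi_hom.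
Proof.
move=> a u u'; apply: tens_hom_eq => x v; apply: dual_sep => f.
rewrite add_lfunE scale_lfunE linearP /= !xi_homE linearP /=.
by rewrite add_lfunE scale_lfunE linearP /= add_lfunE scale_lfunE.
Qed.

Lemma orbit_stab_equivariant u h x :
  w V W (orbit_stab X (T V) (T W) u (rho X h x)) =
  dual_ind_op r h (w V W (orbit_stab X (T V) (T W) u x)).
Proof. by rewrite orbit_stab_act w_act. Qed.

Lemma xi_hom_homrep u : xi_hom u \in homrep (X ⊗A V) W.
Proof.
apply/moved_left_homrep.
apply: (equivariant_moved_left (orbit_stab_equivariant u)) => x v f.
exact: xi_homE.
Qed.

Definition xi : 'Hom(mor (tens_rep X (T V)) (T W), mor (X ⊗A V) W) :=
  linfun (fun u => vsproj (homrep (X ⊗A V) W) (xi_hom u)).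

Lemma val_xi u : vsval (xi u) = xi_hom u.
Proof.
have l : linear (fun u => vsproj (homrep (X ⊗A V) W) (xi_hom u)).
  by move=> a p q; rewrite xi_hom_linear linearP.
by rewrite /xi (linfunE l) vsprojK // xi_hom_homrep.
Qed.

(** The functional attached to x is determined on 1 ⊗ (v ⊗ f) by the image of
    u, hence everywhere by equivariance; then w and Lmap are undone. *)
Lemma xi_inj : injective xi.
Proof.
move=> u u' uu'; apply: subvs_inj; apply: tens_hom_eq => x m.
have e y : w V W (orbit_stab X (T V) (T W) u y) = w V W (orbit_stab X (T V) (T W) u' y).
  apply: ind_dual_eq => h t.
  rewrite (equivariant_cl (orbit_stab_equivariant u)).
  rewrite (equivariant_cl (orbit_stab_equivariant u')).
  have l (v : mor (tens_rep X (T V)) (T W)) : linear (fun t =>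
      w V W (orbit_stab X (T V) (T W) v (rho X (S' h) y)) (ind_cl r 1 t)).
    by apply: lin_comp; exact: lin_ind_cl1.
  rewrite -(linfunE (l u)) -(linfunE (l u')); congr (fun_of_lfun _ t).
  apply: tens_hom_eq => v f; rewrite (linfunE (l u)) (linfunE (l u')).
  by rewrite -!xi_homE -!val_xi uu'.
have /(congr1 vsval) := bij_inj (w_bij V W) (e x).
rewrite !val_orbit_stab => /Lmap_inj /(congr1 (fun y => tens_ev 'Hom(T V, T W) (1 : H) y m)).
by rewrite !orbit_tensE rho1 id_lfunE.
Qed.

(** The three isomorphisms inverted in turn: g defines the functionals
    alpha(x)(h ⊗ (v ⊗ f)) = f(g(S^-1(h) x ⊗ v)), w^-1 sends them to elements
    s(x) of the stabilizer, and u(x ⊗ m) is the value of the family s(x) at 1,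
    applied to m. *)
Lemma xi_surj (g : mor (X ⊗A V) W) : exists u, xi u = g.
Proof.
have gm : moved_left (X := res A X) (vsval g).
  exact/moved_left_homrep/subvsP.
(* With y = S^-1(h) x this is what makes alpha balanced over A. *)
have gl y v (f : dual W) a :
    f (vsval g (rho X (S' (hsub_inc A a)) y ⊗ v)) =
    tlift (fun a1 a2 => f (rho W ((antipode B)^-1%VF a2) (vsval g (y ⊗ rho V a1 v)))
      : k^o) (comul B a).
  by rewrite -hsub_inc_antipodeV -[RHS](linear_tlift _ f) gm /= comp_lfunE.
pose F x (h : H) : dual (tens V (dual W)) :=
  tlift (fun v (f : dual W) => f (vsval g (rho X (S' h) x ⊗ v)) : k^o).
have bF x h : bilin (fun v (f : dual W) => f (vsval g (rho X (S' h) x ⊗ v)) : k^o) by lin.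
have FE x h v f : F x h (v ⊗ f) = f (vsval g (rho X (S' h) x ⊗ v)).
  by rewrite /F tliftE.
have lF x t : linear (fun h => F x h t).
  by apply: lin_tlift => v f; lin.
pose alpha x := ind_lift r (F x).
have alphaE x h t : alpha x (ind_cl r h t) = F x h t.
  apply: ind_liftE => [|{}h a {}t]; first by split=> [{}t|{}h]; [exact: lF | lin].
  rewrite -[RHS](comp_lfunE (F x h)); congr (fun_of_lfun _ t).
  apply: tens_hom_eq => v f; rewrite comp_lfunE tensdual_opE [RHS]linear_tlift.
  rewrite FE antipodeVM rhoM comp_lfunE gl; apply: eq_tlift_at => a1 a2 /=.
  by rewrite FE comp_lfunE.
have alpha_act x h : alpha (rho X h x) = dual_ind_op r h (alpha x).
  apply: ind_dual_eq => z t; rewrite dual_opE ind_opE !alphaE.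
  congr (fun_of_lfun _ t); apply: tens_hom_eq => v f.
  by rewrite !FE antipodeVM antipodeKV rhoM comp_lfunE.
have alpha_lin : linear alpha.
  move=> a x y; apply: ind_dual_eq => h t.
  rewrite add_lfunE scale_lfunE !alphaE -scale_lfunE -add_lfunE.
  congr (fun_of_lfun _ t); apply: tens_hom_eq => v f.
  by rewrite add_lfunE scale_lfunE !FE !linearP /= purePl !linearP.
have [w' wK w'K] := w_bij V W.
pose s x := w' (alpha x).
have s_lin : linear s.
  by move=> a x y; apply: (bij_inj (w_bij V W)); rewrite linearP /= !w'K alpha_lin.
have s_act x h : s (rho X h x) = stab_act h (s x).
  by apply: (bij_inj (w_bij V W)); rewrite w_act !w'K alpha_act.
pose y x := (Lmap (T V) (T W))^-1%VF (vsval (s x)).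
have yE x : Lmap (T V) (T W) (y x) = vsval (s x).
  apply: limg_lfunVK; have := subvsP (s x); rewrite memv_cap; by case/andP.
have y_lin : linear y.
  by move=> a x x'; rewrite /y s_lin [vsval _]linearP /= linearP.
have y_act x h : y (rho X h x) = tmap (hit H h) \1%VF (y x).
  by apply: Lmap_inj; rewrite yE s_act (stab_actE _ (esym (yE x))).
have y_stab x : Lmap (T V) (T W) (y x) \in stab (T V) (T W).
  by rewrite yE subvsP.
pose u0 : 'Hom(tens X (T V), T W) := tlift (fun x m => tens_ev _ (1 : H) (y x) m).
have u0E x m : u0 (x ⊗ m) = tens_ev _ (1 : H) (y x) m.
  by rewrite tliftE //; split=> [n|x'] a p q; rewrite ?y_lin linearP ?add_lfunE ?scale_lfunE.
have u0_orb x : orbit_tens u0 x = y x.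
  apply: tens_ev_inj => t; apply/lfunP => m.
  by rewrite orbit_tensE u0E y_act tens_ev_hit mul1r.
(* K-linearity of u0 is the condition of stabP at t = 1. *)
have u0_homrep : u0 \in homrep (tens_rep X (T V)) (T W).
  apply/homopP => z t; rewrite -!comp_lfunE; congr (fun_of_lfun _ t).
  apply: tens_hom_eq => x m; rewrite [LHS]comp_lfunE [RHS]comp_lfunE.
  rewrite tens_repE linear_tlift u0E -(iffLR (stabP _) (y_stab x)); apply: eq_tlift_at => h m'.
  by rewrite /= u0E y_act tens_ev_hit mul1r mulr1.
exists (Subvs u0_homrep); apply: subvs_inj; rewrite val_xi.
apply: tens_hom_eq => x v; apply: dual_sep => f; rewrite xi_homE.
have -> : orbit_stab X (T V) (T W) (Subvs u0_homrep) x = s x.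
  by apply: subvs_inj; rewrite val_orbit_stab /= u0_orb yE.
by rewrite /s w'K alphaE FE antipodeV1 rho1 id_lfunE.
Qed.

Lemma xi_bij : bijective xi.
Proof.
have k0 : lker xi == 0%VS by apply/lker0P; exact: xi_inj.
exists (xi^-1%VF); first exact: lker0_lfunK.
move=> g; apply: limg_lfunVK; have [u <-] := xi_surj g.
by rewrite memv_img ?memvf.
Qed.

End Xi.
End Adjunction.

Theorem proposition3p9 (k : fieldType) (H : hopfAlg k) (A : hopfSub H)
    (K : comodAlg H) (T : repfunctor (sub_hopf A) K) :
  dynamical_datum T -> dynamical_adjoint T.
Proof.
case=> _ _ [w [w_bij w_act w_nat w_unit]]; exists (xi w); split.
- by move=> X V W; apply: xi_bij.
- move=> X X' V V' W W' p f g u; apply: subvs_inj; rewrite val_xi //.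
  apply: tens_hom_eq => x v; apply: dual_sep => phi.
  rewrite xi_homE orbit_stab_nat w_nat comp_lfunE ind_mapE; last exact: tensdual_map.
  rewrite tmapE dual_mapE -xi_homE -val_xi //.
  by rewrite /= !comp_lfunE tmapE.
move=> V; rewrite val_xi //; apply: tens_hom_eq => c v; apply: dual_sep => f.
rewrite xi_homE orbit_stab_unit linearZ /= scale_lfunE w_unit counit1 mul1r.
by rewrite lunitE linearZ.
Qed.
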